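(* The assignments $(-)^{\bowtie}\colon \mathsf{bRSA}\to\mathsf{SM}$ and $(-)_{\bowtie}\colon\mathsf{SM}\to\mathsf{bRSA}$ described below are functors which witness a (covariant) equivalence of the categories $\mathsf{bRSA}$ and $\mathsf{SM}$.
   Context: A Brouwerian algebra is $(A,\wedge,\vee,\to,t)$ with $(A,\wedge,\vee)$ a lattice with top $t$ and $a\wedge b\le c\iff a\le b\to c$. A relative Stone algebra is a Brouwerian algebra satisfying $(a\to b)\vee(b\to a)=t$. A bRS-algebra is $(A,\wedge,\vee,\to,t,f)$ where $(A,\wedge,\vee,\to,t)$ is a relative Stone algebra and $f\in A$ satisfies $a\vee(a\to f)=t$ for all $a$; $\mathsf{bRSA}$ is the category of bRS-algebras and homomorphisms. A Sugihara monoid is $(A,\wedge,\vee,\cdot,\to,t,\neg)$ with $(A,\wedge,\vee)$ a distributive lattice, $(A,\cdot,t)$ a commutative monoid, $a\cdot b\le c\iff a\le b\to c$, $x\cdot x=x$, $\neg\neg x=x$, $x\to\neg y=y\to\neg x$; $\mathsf{SM}$ is the category of Sugihara monoids and homomorphisms. Functor $(-)_{\bowtie}$: for a Sugihara monoid $\mathbf A$, $\mathbf A_{\bowtie}=(A^-,\wedge,\vee,\to^-,t,\neg t)$ where $A^-=\{a: a\le t\}$ and $a\to^- b=(a\to b)\wedge t$; on morphisms $h_{\bowtie}=h\restriction_{A^-}$. Functor $(-)^{\bowtie}$: for a bRS-algebra $\mathbf A$ put $Na=f\to a$, $\Sigma(\mathbf A)=\{\langle a,b\rangle\in A^2: a\vee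 b=t,\ Nb=b\}$, $A^{\bowtie}=\{\langle a,b\rangle\in A^2: a\vee b=t,\ a\wedge b\le f\}$, with $\langle a,b\rangle\wedge\langle c,d\rangle=\langle a\wedge c,b\vee d\rangle$, $\langle a,b\rangle\vee\langle c,d\rangle=\langle a\vee c,b\wedge d\rangle$. On pairs define $\langle a,b\rangle*\langle c,d\rangle=\langle ((a\to d)\wedge(c\to b))\to(a\wedge c),\ N((a\to d)\wedge(c\to b))\rangle$ and $\langle a,b\rangle\Rightarrow\langle c,d\rangle=\langle (a\to c)\wedge(d\to b),\ N(((a\to c)\wedge(d\to b))\to(a\wedge d))\rangle$. Let $\delta\langle a,b\rangle=\langle a,f\to b\rangle$ and $\varepsilon\langle a,b\rangle=\langle a,b\wedge(a\to f)\rangle$. Then $\mathbf A^{\bowtie}=(A^{\bowtie},\wedge,\vee,\odot,\Rightarrow',\langle t,f\rangle,\sim)$ where $p\odot q=\varepsilon(\delta p*\delta q)$, $p\Rightarrow' q=\varepsilon(\delta p\Rightarrow\delta q)$, and $\sim\langle a,b\rangle=\langle b,a\rangle$. On morphisms $h^{\bowtie}\langle a,b\rangle=\langle h(a),h(b)\rangle$. *)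

(* Defs.v *)
From Stdlib Require Import ProofIrrelevance.

Set Implicit Arguments.
Unset Strict Implicit.

(** * Categories *)

Record category : Type := Category {
  ob :> Type;
  hom : ob -> ob -> Type;
  idm : forall X : ob, hom X X;
  comp : forall X Y Z : ob, hom Y Z -> hom X Y -> hom X Z;
  comp_id_l : forall (X Y : ob) (u : hom X Y), comp (idm Y) u = u;
  comp_id_r : forall (X Y : ob) (u : hom X Y), comp u (idm X) = u;
  comp_assoc : forall (X Y Z W : ob) (w : hom Z W) (v : hom Y Z) (u : hom X Y),
    comp w (comp v u) = comp (comp w v) u
}.
Arguments hom {c} X Y.
Arguments idm {c} X.
Arguments comp {c X Y Z} v u.

(* An assignment on objects and morphisms; [is_functor] is the functor laws. *)
Record assignment (C D : category) : Type := Assignment {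
  on_ob :> C -> D;
  on_hom : forall X Y : C, hom X Y -> hom (on_ob X) (on_ob Y)
}.
Arguments on_hom {C D} a {X Y} u.

Record is_functor (C D : category) (F : assignment C D) : Prop := {
  functor_id : forall X : C, on_hom F (idm X) = idm (F X);
  functor_comp : forall (X Y Z : C) (v : hom Y Z) (u : hom X Y),
    on_hom F (comp v u) = comp (on_hom F v) (on_hom F u)
}.

Definition id_assignment (C : category) : assignment C C :=
  {| on_ob := fun X => X; on_hom := fun X Y u => u |}.

Definition comp_assignment (C D E : category)
    (G : assignment D E) (F : assignment C D) : assignment C E :=
  {| on_ob := fun X => G (F X); on_hom := fun X Y u => on_hom G (on_hom F u) |}.

Definition is_iso (C : category) (X Y : C) (u : hom X Y) : Prop :=
  exists v : hom Y X, comp v u = idm X /\ comp u v = idm Y.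

Definition naturally_isomorphic (C D : category) (F G : assignment C D) : Prop :=
  exists eta : forall X : C, hom (F X) (G X),
    (forall (X Y : C) (u : hom X Y),
       comp (on_hom G u) (eta X) = comp (eta Y) (on_hom F u)) /\
    (forall X : C, is_iso (eta X)).

Definition witness_equivalence (C D : category)
    (F : assignment C D) (G : assignment D C) : Prop :=
  is_functor F /\ is_functor G /\
  naturally_isomorphic (id_assignment C) (comp_assignment G F) /\
  naturally_isomorphic (comp_assignment F G) (id_assignment D).

(** * Lattices *)

Record is_lattice (T : Type) (meet join : T -> T -> T) : Prop := {
  meetC : forall a b, meet a b = meet b a;
  joinC : forall a b, join a b = join b a;
  meetA : forall a b c, meet a (meet b c) = meet (meet a b) c;
  joinA : forall a b c, join a (join b c) = join (join a b) c;
  meet_joinK : forall a b, meet a (join a b) = a;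
  join_meetK : forall a b, join a (meet a b) = a
}.

(** * bRS-algebras *)

Record bRS_sig : Type := BRSSig {
  bcar :> Type;
  bmeet : bcar -> bcar -> bcar;
  bjoin : bcar -> bcar -> bcar;
  bimp : bcar -> bcar -> bcar;
  bt : bcar;
  bf : bcar
}.
Arguments bmeet {b} _ _.
Arguments bjoin {b} _ _.
Arguments bimp {b} _ _.
Arguments bt {b}.
Arguments bf {b}.

Definition ble (A : bRS_sig) (a b : A) : Prop := bmeet a b = a.

Declare Scope bRS_scope.
Delimit Scope bRS_scope with bRS.
Notation "a ⊓ b" := (bmeet a b) (at level 40, left associativity) : bRS_scope.
Notation "a ⊔ b" := (bjoin a b) (at level 50, left associativity) : bRS_scope.
Notation "a ⇀ b" := (bimp a b) (at level 55, right associativity) : bRS_scope.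
Notation "a ⊑ b" := (ble a b) (at level 70, no associativity) : bRS_scope.

Record is_Brouwerian (A : bRS_sig) : Prop := {
  Brouwerian_lattice : is_lattice (@bmeet A) (@bjoin A);
  Brouwerian_top : forall a : A, (a ⊑ bt)%bRS;
  Brouwerian_residuation : forall a b c : A, (a ⊓ b ⊑ c <-> a ⊑ (b ⇀ c))%bRS
}.

Record is_relative_Stone (A : bRS_sig) : Prop := {
  relative_Stone_Brouwerian : is_Brouwerian A;
  relative_Stone_prelinear : forall a b : A, ((a ⇀ b) ⊔ (b ⇀ a) = bt)%bRS
}.

Record is_bRS (A : bRS_sig) : Prop := {
  bRS_relative_Stone : is_relative_Stone A;
  bRS_f : forall a : A, (a ⊔ (a ⇀ bf) = bt)%bRS
}.

Record bRS_algebra : Type := BRSAlgebra {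
  bRS_ops :> bRS_sig;
  bRS_axioms : is_bRS bRS_ops
}.

Record is_bRS_hom (A B : bRS_sig) (h : A -> B) : Prop := {
  bRS_hom_meet : forall a b : A, h (bmeet a b) = bmeet (h a) (h b);
  bRS_hom_join : forall a b : A, h (bjoin a b) = bjoin (h a) (h b);
  bRS_hom_imp : forall a b : A, h (bimp a b) = bimp (h a) (h b);
  bRS_hom_t : h bt = bt;
  bRS_hom_f : h bf = bf
}.

Record bRS_hom (A B : bRS_algebra) : Type := BRSHom {
  bRS_fun :> A -> B;
  bRS_funP : is_bRS_hom bRS_fun
}.

Lemma bRS_hom_eq (A B : bRS_algebra) (g h : bRS_hom A B) :
  bRS_fun g = bRS_fun h -> g = h.
Proof.
  destruct g as [g Hg], h as [h Hh]; simpl; intros e; subst h.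
  f_equal; apply proof_irrelevance.
Qed.

Lemma bRS_id_hom (A : bRS_algebra) : @is_bRS_hom A A (fun a => a).
Proof. split; reflexivity. Qed.

Lemma bRS_comp_hom (A B C : bRS_algebra) (h : bRS_hom B C) (g : bRS_hom A B) :
  @is_bRS_hom A C (fun a => h (g a)).
Proof.
  destruct g as [g Hg], h as [h Hh]; simpl; destruct Hg, Hh.
  split; intros; congruence.
Qed.

Definition bRSA : category.
Proof.
  refine {| ob := bRS_algebra;
            hom := bRS_hom;
            idm := fun A => BRSHom (bRS_id_hom A);
            comp := fun A B C h g => BRSHom (bRS_comp_hom h g) |};
    intros; apply bRS_hom_eq; reflexivity.
Defined.

(** * Sugihara monoids *)

Record SM_sig : Type := SMSig {
  scar :> Type;
  smeet : scar -> scar -> scar;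
  sjoin : scar -> scar -> scar;
  smul : scar -> scar -> scar;
  simp : scar -> scar -> scar;
  st : scar;
  sneg : scar -> scar
}.
Arguments smeet {s} _ _.
Arguments sjoin {s} _ _.
Arguments smul {s} _ _.
Arguments simp {s} _ _.
Arguments st {s}.
Arguments sneg {s} _.

Definition sle (S : SM_sig) (x y : S) : Prop := smeet x y = x.

Record is_SM (S : SM_sig) : Prop := {
  SM_lattice : is_lattice (@smeet S) (@sjoin S);
  SM_distributive : forall x y z : S,
    smeet x (sjoin y z) = sjoin (smeet x y) (smeet x z);
  SM_mulA : forall x y z : S, smul x (smul y z) = smul (smul x y) z;
  SM_mulC : forall x y : S, smul x y = smul y x;
  SM_mul1 : forall x : S, smul x st = x;
  SM_residuation : forall x y z : S, sle (smul x y) z <-> sle x (simp y z);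
  SM_mul_idem : forall x : S, smul x x = x;
  SM_negK : forall x : S, sneg (sneg x) = x;
  SM_contraposition : forall x y : S, simp x (sneg y) = simp y (sneg x)
}.

Record SM_algebra : Type := SMAlgebra {
  SM_ops :> SM_sig;
  SM_axioms : is_SM SM_ops
}.

Record is_SM_hom (S T : SM_sig) (h : S -> T) : Prop := {
  SM_hom_meet : forall x y : S, h (smeet x y) = smeet (h x) (h y);
  SM_hom_join : forall x y : S, h (sjoin x y) = sjoin (h x) (h y);
  SM_hom_mul : forall x y : S, h (smul x y) = smul (h x) (h y);
  SM_hom_imp : forall x y : S, h (simp x y) = simp (h x) (h y);
  SM_hom_t : h st = st;
  SM_hom_neg : forall x : S, h (sneg x) = sneg (h x)
}.

Record SM_hom (S T : SM_algebra) : Type := SMHom {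
  SM_fun :> S -> T;
  SM_funP : is_SM_hom SM_fun
}.

Lemma SM_hom_eq (S T : SM_algebra) (g h : SM_hom S T) :
  SM_fun g = SM_fun h -> g = h.
Proof.
  destruct g as [g Hg], h as [h Hh]; simpl; intros e; subst h.
  f_equal; apply proof_irrelevance.
Qed.

Lemma SM_id_hom (S : SM_algebra) : @is_SM_hom S S (fun x => x).
Proof. split; reflexivity. Qed.

Lemma SM_comp_hom (S T U : SM_algebra) (h : SM_hom T U) (g : SM_hom S T) :
  @is_SM_hom S U (fun x => h (g x)).
Proof.
  destruct g as [g Hg], h as [h Hh]; simpl; destruct Hg, Hh.
  split; intros; congruence.
Qed.

Definition SM : category.
Proof.
  refine {| ob := SM_algebra;
            hom := SM_hom;
            idm := fun S => SMHom (SM_id_hom S);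
            comp := fun S T U h g => SMHom (SM_comp_hom h g) |};
    intros; apply SM_hom_eq; reflexivity.
Defined.

(** * The assignment [(-)_bowtie : SM -> bRSA] *)

Definition in_neg_cone (S : SM_sig) (x : S) : Prop := sle x st.

Definition neg_imp (S : SM_sig) (x y : S) : S := smeet (simp x y) st.

Record lower_closed (S : SM_sig) : Prop := {
  lower_meet : forall x y : S,
    in_neg_cone x -> in_neg_cone y -> in_neg_cone (smeet x y);
  lower_join : forall x y : S,
    in_neg_cone x -> in_neg_cone y -> in_neg_cone (sjoin x y);
  lower_imp : forall x y : S,
    in_neg_cone x -> in_neg_cone y -> in_neg_cone (neg_imp x y);
  lower_t : in_neg_cone (@st S);
  lower_f : in_neg_cone (sneg (@st S))
}.

Definition lower_sig (S : SM_sig) (c : lower_closed S) : bRS_sig := {|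
  bcar := {x : S | in_neg_cone x};
  bmeet := fun x y => exist _ (smeet (proj1_sig x) (proj1_sig y))
                        (lower_meet c (proj2_sig x) (proj2_sig y));
  bjoin := fun x y => exist _ (sjoin (proj1_sig x) (proj1_sig y))
                        (lower_join c (proj2_sig x) (proj2_sig y));
  bimp := fun x y => exist _ (neg_imp (proj1_sig x) (proj1_sig y))
                       (lower_imp c (proj2_sig x) (proj2_sig y));
  bt := exist _ st (lower_t c);
  bf := exist _ (sneg st) (lower_f c)
|}.

Definition restrict (S T : Type) (P : S -> Prop) (Q : T -> Prop) (h : S -> T)
    (PQ : forall x, P x -> Q (h x)) (x : {x : S | P x}) : {y : T | Q y} :=
  exist _ (h (proj1_sig x)) (PQ (proj1_sig x) (proj2_sig x)).

(* The facts needed for the construction to land in [bRSA], on objects and on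
   morphisms. *)
Record lower_well_defined : Prop := {
  lower_ob_closed : forall S : SM_algebra, lower_closed S;
  lower_ob_bRS : forall S : SM_algebra, is_bRS (lower_sig (lower_ob_closed S));
  lower_hom_closed : forall (S T : SM_algebra) (h : SM_hom S T) (x : S),
    in_neg_cone x -> in_neg_cone (h x);
  lower_hom_bRS : forall (S T : SM_algebra) (h : SM_hom S T),
    @is_bRS_hom (lower_sig (lower_ob_closed S)) (lower_sig (lower_ob_closed T))
      (restrict (lower_hom_closed h))
}.

Definition lower_ob (w : lower_well_defined) (S : SM_algebra) : bRS_algebra :=
  BRSAlgebra (lower_ob_bRS w S).

Definition lower_hom (w : lower_well_defined) (S T : SM_algebra)
    (h : SM_hom S T) : bRS_hom (lower_ob w S) (lower_ob w T) :=
  @BRSHom (lower_ob w S) (lower_ob w T) _ (lower_hom_bRS w h).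

Definition bowtie_lower (w : lower_well_defined) : assignment SM bRSA :=
  @Assignment SM bRSA (lower_ob w) (lower_hom w).

(** * The assignment [(-)^bowtie : bRSA -> SM] *)

Definition bN (A : bRS_sig) (a : A) : A := (bf ⇀ a)%bRS.

Definition in_bowtie (A : bRS_sig) (p : A * A) : Prop :=
  let (a, b) := p in (a ⊔ b = bt /\ a ⊓ b ⊑ bf)%bRS.

Definition pair_meet (A : bRS_sig) (p q : A * A) : A * A :=
  let (a, b) := p in let (c, d) := q in (a ⊓ c, b ⊔ d)%bRS.

Definition pair_join (A : bRS_sig) (p q : A * A) : A * A :=
  let (a, b) := p in let (c, d) := q in (a ⊔ c, b ⊓ d)%bRS.

Definition pair_star (A : bRS_sig) (p q : A * A) : A * A :=
  let (a, b) := p in let (c, d) := q in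
  (((a ⇀ d) ⊓ (c ⇀ b)) ⇀ (a ⊓ c), bN ((a ⇀ d) ⊓ (c ⇀ b)))%bRS.

Definition pair_arrow (A : bRS_sig) (p q : A * A) : A * A :=
  let (a, b) := p in let (c, d) := q in
  ((a ⇀ c) ⊓ (d ⇀ b), bN (((a ⇀ c) ⊓ (d ⇀ b)) ⇀ (a ⊓ d)))%bRS.

Definition delta (A : bRS_sig) (p : A * A) : A * A :=
  let (a, b) := p in (a, bf ⇀ b)%bRS.

Definition epsilon (A : bRS_sig) (p : A * A) : A * A :=
  let (a, b) := p in (a, b ⊓ (a ⇀ bf))%bRS.

Definition pair_mul (A : bRS_sig) (p q : A * A) : A * A :=
  epsilon (pair_star (delta p) (delta q)).

Definition pair_imp (A : bRS_sig) (p q : A * A) : A * A :=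
  epsilon (pair_arrow (delta p) (delta q)).

Definition pair_neg (A : bRS_sig) (p : A * A) : A * A :=
  let (a, b) := p in (b, a).

Definition pair_map (A B : bRS_sig) (h : A -> B) (p : A * A) : B * B :=
  let (a, b) := p in (h a, h b).

Record upper_closed (A : bRS_sig) : Prop := {
  upper_meet : forall p q : A * A,
    in_bowtie p -> in_bowtie q -> in_bowtie (pair_meet p q);
  upper_join : forall p q : A * A,
    in_bowtie p -> in_bowtie q -> in_bowtie (pair_join p q);
  upper_mul : forall p q : A * A,
    in_bowtie p -> in_bowtie q -> in_bowtie (pair_mul p q);
  upper_imp : forall p q : A * A,
    in_bowtie p -> in_bowtie q -> in_bowtie (pair_imp p q);
  upper_t : in_bowtie (@bt A, @bf A);
  upper_neg : forall p : A * A, in_bowtie p -> in_bowtie (pair_neg p)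
}.

Definition upper_sig (A : bRS_sig) (c : upper_closed A) : SM_sig := {|
  scar := {p : A * A | in_bowtie p};
  smeet := fun p q => exist _ (pair_meet (proj1_sig p) (proj1_sig q))
                        (upper_meet c (proj2_sig p) (proj2_sig q));
  sjoin := fun p q => exist _ (pair_join (proj1_sig p) (proj1_sig q))
                        (upper_join c (proj2_sig p) (proj2_sig q));
  smul := fun p q => exist _ (pair_mul (proj1_sig p) (proj1_sig q))
                       (upper_mul c (proj2_sig p) (proj2_sig q));
  simp := fun p q => exist _ (pair_imp (proj1_sig p) (proj1_sig q))
                       (upper_imp c (proj2_sig p) (proj2_sig q));
  st := exist _ (bt, bf) (upper_t c);
  sneg := fun p => exist _ (pair_neg (proj1_sig p)) (upper_neg c (proj2_sig p))
|}.

(* The facts needed for the construction to land in [SM], on objects and on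
   morphisms. *)
Record upper_well_defined : Prop := {
  upper_ob_closed : forall A : bRS_algebra, upper_closed A;
  upper_ob_SM : forall A : bRS_algebra, is_SM (upper_sig (upper_ob_closed A));
  upper_hom_closed : forall (A B : bRS_algebra) (h : bRS_hom A B) (p : A * A),
    in_bowtie p -> in_bowtie (pair_map h p);
  upper_hom_SM : forall (A B : bRS_algebra) (h : bRS_hom A B),
    @is_SM_hom (upper_sig (upper_ob_closed A)) (upper_sig (upper_ob_closed B))
      (restrict (upper_hom_closed h))
}.

Definition upper_ob (w : upper_well_defined) (A : bRS_algebra) : SM_algebra :=
  SMAlgebra (upper_ob_SM w A).

Definition upper_hom (w : upper_well_defined) (A B : bRS_algebra)
    (h : bRS_hom A B) : SM_hom (upper_ob w A) (upper_ob w B) :=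
  @SMHom (upper_ob w A) (upper_ob w B) _ (upper_hom_SM w h).

Definition bowtie_upper (w : upper_well_defined) : assignment bRSA SM :=
  @Assignment bRSA SM (upper_ob w) (upper_hom w).

(* Main.v *)
(** A bRS-algebra is separated by its prime filters.  Each of them induces a
    total preorder in which an implication is the top or its conclusion, and in
    which every element is the top or lies below [f].  Over such a preorder the
    pairs of the bowtie construction form a chain with the antitone involution
    [~], on which [p ⊙ q] is the meet of [p] and [q] if [p <= ~q], and their
    join otherwise.  Hence [p ⊙ q <= r] holds iff at least two of [p <= ~q],
    [p <= r], [q <= r] do, and [p <= (q => r)] turns out to be the same
    condition; the laws of Sugihara monoids follow by propositional reasoning.

    Every Sugihara monoid satisfies this majority law in the following sense:
    the element [((x . y) -> z) /\ t] of the negative cone is the majority of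
    [(x -> ~y) /\ t], [(x -> z) /\ t] and [(y -> z) /\ t].  Moreover
    [(x -> y) /\ t] is determined by the lattice, the negation and [t], so a
    lattice isomorphism preserving the negation and [t] is an isomorphism of
    Sugihara monoids.  Such an isomorphism is [x |-> (x /\ t, ~x /\ t)], with
    inverse [(a, b) |-> a . ~b].  On the other side, a pair [(a, b)] below
    [(t, f)] satisfies [b = a -> f], so its first component determines it. *)

From Stdlib Require Import Setoid Morphisms ProofIrrelevance.
From mathcomp Require Import ssreflect ssrfun ssrbool boolp classical_sets.
Require Import Defs.

Set Implicit Arguments.
Unset Strict Implicit.
Unset Printing Implicit Defensive.

Lemma sig_val_inj (T : Type) (P : T -> Prop) (u v : {x | P x}) :
  proj1_sig u = proj1_sig v -> u = v.
Proof. by apply: eq_sig_hprop => x p q; exact: proof_irrelevance. Qed.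

(** * Lattices *)

Record is_lattice_order (T : Type) (meet join : T -> T -> T)
    (le : T -> T -> Prop) : Prop := {
  lattice_order_lattice : is_lattice meet join;
  lat_leE : forall x y, le x y <-> meet x y = x
}.

Section Lattice.

Variables (T : Type) (meet join : T -> T -> T) (le : T -> T -> Prop).
Hypothesis ordT : is_lattice_order meet join le.

Let latT := lattice_order_lattice ordT.

Local Notation "x ∧ y" := (meet x y) (at level 40, left associativity).
Local Notation "x ∨ y" := (join x y) (at level 50, left associativity).
Local Notation "x ≤ y" := (le x y) (at level 70, no associativity).

Lemma lat_meetxx (x : T) : x ∧ x = x.
Proof. by rewrite -{2}(join_meetK latT x x) (meet_joinK latT). Qed.

Lemma lat_lexx (x : T) : x ≤ x.
Proof. exact/(lat_leE ordT)/lat_meetxx. Qed.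

Lemma lat_le_trans (y x z : T) : x ≤ y -> y ≤ z -> x ≤ z.
Proof. by rewrite !(lat_leE ordT) => <- yz; rewrite -(meetA latT) yz. Qed.

Lemma lat_le_anti (x y : T) : x ≤ y -> y ≤ x -> x = y.
Proof. by rewrite !(lat_leE ordT) => xy yx; rewrite -xy (meetC latT) yx. Qed.

Lemma lat_eq_le (x y : T) : (forall z, z ≤ x <-> z ≤ y) -> x = y.
Proof. by move=> xy; apply: lat_le_anti; apply/xy; exact: lat_lexx. Qed.

Lemma lat_eq_ge (x y : T) : (forall z, x ≤ z <-> y ≤ z) -> x = y.
Proof. by move=> xy; apply: lat_le_anti; apply/xy; exact: lat_lexx. Qed.

Lemma lat_leIr (x y : T) : x ∧ y ≤ y.
Proof. by rewrite (lat_leE ordT) -(meetA latT) lat_meetxx. Qed.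

Lemma lat_leIl (x y : T) : x ∧ y ≤ x.
Proof. by rewrite (meetC latT); exact: lat_leIr. Qed.

Lemma lat_lexI (x y z : T) : z ≤ x ∧ y <-> z ≤ x /\ z ≤ y.
Proof.
split=> [zxy | [zx zy]]; last first.
  by move: zx zy; rewrite !(lat_leE ordT) (meetA latT) => ->.
by split; apply: lat_le_trans zxy _; [exact: lat_leIl | exact: lat_leIr].
Qed.

Lemma lat_leI2 (x y z w : T) : x ≤ z -> y ≤ w -> x ∧ y ≤ z ∧ w.
Proof.
move=> xz yw; apply/lat_lexI; split.
  exact: lat_le_trans (lat_leIl _ _) xz.
exact: lat_le_trans (lat_leIr _ _) yw.
Qed.

Lemma lat_leUl (x y : T) : x ≤ x ∨ y.
Proof. exact/(lat_leE ordT)/(meet_joinK latT). Qed.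

Lemma lat_leUr (x y : T) : y ≤ x ∨ y.
Proof. by rewrite (joinC latT); exact: lat_leUl. Qed.

Lemma lat_join_r (x y : T) : x ≤ y <-> x ∨ y = y.
Proof.
split=> [/(lat_leE ordT) <- | <-]; last exact: lat_leUl.
by rewrite (joinC latT) (meetC latT) (join_meetK latT).
Qed.

Lemma lat_leUx (x y z : T) : x ∨ y ≤ z <-> x ≤ z /\ y ≤ z.
Proof.
split=> [xyz | [/lat_join_r xz /lat_join_r yz]].
  by split; apply: lat_le_trans xyz; [exact: lat_leUl | exact: lat_leUr].
by apply/lat_join_r; rewrite -(joinA latT) yz xz.
Qed.

Lemma lat_leU2 (x y z w : T) : x ≤ z -> y ≤ w -> x ∨ y ≤ z ∨ w.
Proof.
move=> xz yw; apply/lat_leUx; split.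
  exact: lat_le_trans xz (lat_leUl _ _).
exact: lat_le_trans yw (lat_leUr _ _).
Qed.

Definition is_filter (F : T -> Prop) : Prop :=
  forall x y, F (x ∧ y) <-> F x /\ F y.

Lemma filter_up (F : T -> Prop) (x y : T) : is_filter F -> x ≤ y -> F x -> F y.
Proof. by move=> filF /(lat_leE ordT) <- /filF []. Qed.

Lemma is_filter_bigcup (C : set (set T)) :
  (forall F, C F -> is_filter F) -> total_on C subset ->
  is_filter (\bigcup_(F in C) F)%classic.
Proof.
move=> filC totC x y; split=> [[F CF] | [[F CF Fx] [G CG Gy]]].
  by move=> /(filC _ CF) [Fx Fy]; split; exists F.
have [FG | GF] := totC _ _ CF CG.
- by exists G => //; apply/(filC _ CG); split=> //; exact: FG.
- by exists F => //; apply/(filC _ CF); split=> //; exact: GF.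
Qed.

Lemma is_filter_principal (a : T) : is_filter (le a).
Proof. by move=> x y; exact: lat_lexI. Qed.

Definition filter_adjoin (F : T -> Prop) (a : T) : T -> Prop :=
  fun x => exists2 c, F c & c ∧ a ≤ x.

Lemma is_filter_adjoin (F : T -> Prop) (a : T) :
  is_filter F -> is_filter (filter_adjoin F a).
Proof.
move=> filF x y; split=> [[c Fc /lat_lexI [cx cy]] | [[c Fc cx] [d Fd dy]]].
  by split; exists c.
exists (c ∧ d); first exact/filF.
apply/lat_lexI; split.
- by apply: lat_le_trans cx; apply: lat_leI2 (lat_leIl _ _) (lat_lexx _).
- by apply: lat_le_trans dy; apply: lat_leI2 (lat_leIr _ _) (lat_lexx _).
Qed.

(* The empty filter has to be admitted, being the union of the empty chain. *)
Definition separating_filter (a b : T) (F : set T) : Prop :=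
  [/\ is_filter F, forall x, F x -> F a & ~ F b].

Lemma separating_filter_bigcup (a b : T) (C : set (set T)) :
  (forall F, C F -> separating_filter a b F) -> total_on C subset ->
  separating_filter a b (\bigcup_(F in C) F)%classic.
Proof.
move=> sepC totC; split.
- by apply: is_filter_bigcup totC => F /sepC [].
- move=> x [F CF Fx]; exists F => //.
  by have [_ F_a _] := sepC _ CF; exact: F_a Fx.
- by move=> [F CF Fb]; have [_ _] := sepC _ CF; apply.
Qed.

Lemma maximal_separating_filter (a b : T) : ~ a ≤ b ->
  exists F : set T, [/\ is_filter F, F a, ~ F b &
    forall x, ~ F x -> filter_adjoin F x b].
Proof.
move=> ab.
have [F [[filF Fa Fb] maxF]] :=
  Zorn_bigcup (@separating_filter_bigcup a b).
have {}maxF G :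
    separating_filter a b G -> (F `<=` G)%classic -> (G `<=` F)%classic.
  by move=> sepG FG; apply: contrapT => GF; apply: maxF sepG; split.
have {}Fa : F a.
  apply: contrapT => Fa'.
  apply/Fa'/(maxF (le a)); last exact: lat_lexx.
  - by split=> //; [exact: is_filter_principal | move=> x _; exact: lat_lexx].
  - by move=> x /Fa.
exists F; split=> // x Fx; apply: contrapT => Fxb; apply: Fx.
apply: (maxF (filter_adjoin F x)); last by exists a => //; exact: lat_leIr.
- split=> //; first exact: is_filter_adjoin.
  by move=> _ _; exists a => //; exact: lat_leIl.
- by move=> y Fy; exists y => //; exact: lat_leIl.
Qed.

Record is_prime_filter (F : T -> Prop) : Prop := {
  prime_filter_meet : forall x y, F (x ∧ y) <-> F x /\ F y;
  prime_filter_join : forall x y, F (x ∨ y) <-> F x \/ F y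
}.

Lemma prime_filter_separation (a b : T) :
  (forall x y z, x ∧ (y ∨ z) = (x ∧ y) ∨ (x ∧ z)) -> ~ a ≤ b ->
  exists F : T -> Prop, [/\ is_prime_filter F, F a & ~ F b].
Proof.
move=> distr /maximal_separating_filter [F [filF Fa Fb maxF]].
exists F; split=> //; split=> [|x y]; first exact: filF.
split=> [Fxy | [|]]; last 2 first.
- exact: filter_up filF (lat_leUl _ _).
- exact: filter_up filF (lat_leUr _ _).
apply: contrapT => /not_orP [/maxF [c Fc cx] /maxF [d Fd dy]]; apply: Fb.
apply: (filter_up (x := (c ∧ d) ∧ (x ∨ y))) => //; last by rewrite !filF.
rewrite distr; apply/lat_leUx; split.
- by apply: lat_le_trans cx; apply: lat_leI2 (lat_leIl _ _) (lat_lexx _).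
- by apply: lat_le_trans dy; apply: lat_leI2 (lat_leIr _ _) (lat_lexx _).
Qed.

End Lattice.

(* A total preorder, not an order: its classes are the elements of the chain. *)
Record is_lattice_chain (T : Type) (meet join : T -> T -> T)
    (le : T -> T -> Prop) : Prop := {
  chain_refl : forall x, le x x;
  chain_trans : forall x y z, le x y -> le y z -> le x z;
  chain_total : forall x y, le x y \/ le y x;
  chain_lexI : forall x y z, le z (meet x y) <-> le z x /\ le z y;
  chain_leUx : forall x y z, le (join x y) z <-> le x z /\ le y z
}.

Definition chain_eqv (T : Type) (le : T -> T -> Prop) (x y : T) : Prop :=
  le x y /\ le y x.

Section LatticeChain.

Variables (T : Type) (meet join : T -> T -> T) (le : T -> T -> Prop).
Hypothesis chT : is_lattice_chain meet join le.

Local Notation "x ∧ y" := (meet x y) (at level 40, left associativity).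
Local Notation "x ∨ y" := (join x y) (at level 50, left associativity).
Local Notation "x ≤ y" := (le x y) (at level 70, no associativity).
Local Notation "x ≡ y" := (chain_eqv le x y) (at level 70, no associativity).

Let refl := chain_refl chT.
Let trans := chain_trans chT.

Lemma chain_of_meet (x y : T) : x ∧ y = x -> x ≤ y.
Proof. by move=> xy; have [] := proj1 (chain_lexI chT x y x); rewrite ?xy. Qed.

Lemma chain_nle (x y : T) : ~ x ≤ y -> y ≤ x.
Proof. by have := chain_total chT x y; tauto. Qed.

Lemma chain_leIx (x y z : T) : x ∧ y ≤ z <-> x ≤ z \/ y ≤ z.
Proof.
have [Ix Iy] := proj1 (chain_lexI chT x y _) (refl _).
split=> [xyz | [xz | yz]]; [ | exact: trans Ix xz | exact: trans Iy yz].
by have [xy | yx] := chain_total chT x y; [left | right];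
  apply: trans xyz; apply/(chain_lexI chT).
Qed.

Lemma chain_lexU (x y z : T) : z ≤ x ∨ y <-> z ≤ x \/ z ≤ y.
Proof.
have [xU yU] := proj1 (chain_leUx chT x y _) (refl _).
split=> [zxy | [zx | zy]]; [ | exact: trans zx xU | exact: trans zy yU].
by have [xy | yx] := chain_total chT x y; [right | left];
  apply: (trans zxy); apply/(chain_leUx chT).
Qed.

Lemma chain_eqv_le (x y : T) : (forall z, z ≤ x <-> z ≤ y) -> x ≡ y.
Proof. by move=> xy; split; apply/xy. Qed.

Lemma chain_eqv_ge (x y : T) : (forall z, x ≤ z <-> y ≤ z) -> x ≡ y.
Proof. by move=> xy; split; apply/xy. Qed.

Lemma chain_meet_l (x y : T) : x ≤ y -> x ∧ y ≡ x.
Proof.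
move=> xy; apply: chain_eqv_le => z; rewrite (chain_lexI chT).
by split=> [[] | zx] //; split=> //; exact: trans zx xy.
Qed.

#[local] Instance chain_eqv_equivalence : Equivalence (chain_eqv le).
Proof.
split=> [x | x y [xy yx] | x y z [xy yx] [yz zy]]; split=> //.
- exact: trans xy yz.
- exact: trans zy yx.
Qed.

#[local] Instance chain_le_proper :
  Proper (chain_eqv le ==> chain_eqv le ==> iff) le.
Proof.
move=> x x' [xx' x'x] y y' [yy' y'y]; split=> [xy | xy'].
- exact: trans (trans x'x xy) yy'.
- exact: trans (trans xx' xy') y'y.
Qed.

Lemma chain_meet_proper :
  Proper (chain_eqv le ==> chain_eqv le ==> chain_eqv le) meet.
Proof.
move=> x x' xx' y y' yy'; apply: chain_eqv_le => z.
by rewrite !(chain_lexI chT) xx' yy'.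
Qed.

Lemma chain_join_proper :
  Proper (chain_eqv le ==> chain_eqv le ==> chain_eqv le) join.
Proof.
move=> x x' xx' y y' yy'; apply: chain_eqv_le => z.
by rewrite !chain_lexU xx' yy'.
Qed.

End LatticeChain.

(** * Brouwerian algebras *)

Local Open Scope bRS_scope.

Lemma ble_lattice_order (A : bRS_sig) :
  is_Brouwerian A -> is_lattice_order (@bmeet A) (@bjoin A) (@ble A).
Proof. by move=> brA; split; first exact: Brouwerian_lattice. Qed.

Section Brouwerian.

Variable A : bRS_sig.
Hypothesis brA : is_Brouwerian A.

Let latA := Brouwerian_lattice brA.
Let ordA := ble_lattice_order brA.
Let bimpP := Brouwerian_residuation brA.

Lemma bimpPl (a b c : A) : a ⊓ b ⊑ c <-> b ⊑ a ⇀ c.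
Proof. by rewrite (meetC latA); exact: bimpP. Qed.

Lemma bmeetUr (a b c : A) : a ⊓ (b ⊔ c) = (a ⊓ b) ⊔ (a ⊓ c).
Proof.
apply: (lat_eq_ge ordA) => d.
by rewrite bimpPl !(lat_leUx ordA) -!bimpPl.
Qed.

Lemma bmeett (a : A) : a ⊓ bt = a.
Proof. exact: Brouwerian_top brA a. Qed.

Lemma btmeet (a : A) : bt ⊓ a = a.
Proof. by rewrite (meetC latA) bmeett. Qed.

Lemma btjoin (a : A) : bt ⊔ a = bt.
Proof. by rewrite -{1}(btmeet a) (join_meetK latA). Qed.

Lemma bjoint (a : A) : a ⊔ bt = bt.
Proof. by rewrite (joinC latA) btjoin. Qed.

Lemma btop_le (a : A) : bt ⊑ a <-> a = bt.
Proof. by rewrite /ble btmeet. Qed.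

Lemma bimp_eq_top (a b : A) : a ⇀ b = bt <-> a ⊑ b.
Proof. by rewrite -btop_le -bimpP btmeet. Qed.

Lemma bimpt (a : A) : a ⇀ bt = bt.
Proof. exact/bimp_eq_top/bmeett. Qed.

Lemma btimp (a : A) : bt ⇀ a = a.
Proof. by apply: (lat_eq_le ordA) => b; rewrite -(bimpP b) bmeett. Qed.

Lemma ble_imp (a b : A) : b ⊑ a ⇀ b.
Proof. exact/bimpP/(lat_leIl ordA). Qed.

Lemma bmeet_imp (a b : A) : a ⊓ (a ⇀ b) = a ⊓ b.
Proof.
apply: (lat_eq_le ordA) => c; rewrite !(lat_lexI ordA) -(bimpP c).
by split=> -[ca]; rewrite ca.
Qed.

Lemma bimp_meet (a b : A) : (a ⇀ b) ⊓ a = b ⊓ a.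
Proof. by rewrite (meetC latA) bmeet_imp (meetC latA). Qed.

Lemma bimp_curry (a b c : A) : (a ⊓ b) ⇀ c = a ⇀ (b ⇀ c).
Proof.
by apply: (lat_eq_le ordA) => d; rewrite -!(bimpP d) -bimpP (meetA latA).
Qed.

Lemma bimpI (a b c : A) : c ⇀ (a ⊓ b) = (c ⇀ a) ⊓ (c ⇀ b).
Proof.
apply: (lat_eq_le ordA) => d.
by rewrite (lat_lexI ordA) -!bimpP (lat_lexI ordA).
Qed.

Lemma bimpU (a b c : A) : (a ⊔ b) ⇀ c = (a ⇀ c) ⊓ (b ⇀ c).
Proof.
apply: (lat_eq_le ordA) => d.
by rewrite (lat_lexI ordA) -!bimpPl !bimpP (lat_leUx ordA).
Qed.

Lemma bimp_trans (a b c : A) : (a ⇀ b) ⊓ (b ⇀ c) ⊑ a ⇀ c.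
Proof.
rewrite -bimpP (meetC latA _ a) (meetA latA) bmeet_imp -(meetA latA).
by rewrite bmeet_imp (meetA latA); exact: (lat_leIr ordA).
Qed.

End Brouwerian.

Record is_bRS_chain (A : bRS_sig) (le : A -> A -> Prop) : Prop := {
  bRS_chain_lattice :> is_lattice_chain (@bmeet A) (@bjoin A) le;
  bRS_chain_imp : forall a b c, le (a ⊓ b) c <-> le a (b ⇀ c);
  bRS_chain_top : forall a, le a bt;
  bRS_chain_f : forall a, le bt a \/ le a bf
}.

Section Separation.

Variable A : bRS_sig.
Hypothesis brsA : is_bRS A.

Let brA := relative_Stone_Brouwerian (bRS_relative_Stone brsA).
Let ordA := ble_lattice_order brA.

Lemma bRS_chain_of_prime_filter (F : A -> Prop) :
  is_prime_filter (@bmeet A) (@bjoin A) F -> F bt ->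
  is_bRS_chain (fun a b => F (a ⇀ b)).
Proof.
move=> [FI FU] Ft.
have F_up a b : a ⊑ b -> F a -> F b by move=> <- /FI [].
split; first split.
- by move=> a; rewrite (proj2 (bimp_eq_top brA a a)) //; exact: (lat_lexx ordA).
- by move=> a b c Fab Fbc; apply: F_up (bimp_trans brA a b c) _; apply/FI.
- move=> a b; apply/FU.
  by rewrite (relative_Stone_prelinear (bRS_relative_Stone brsA)).
- by move=> a b c; rewrite (bimpI brA).
- by move=> a b c; rewrite (bimpU brA).
- by move=> a b c; rewrite (bimp_curry brA).
- by move=> a; rewrite (bimpt brA).
- by move=> a; rewrite (btimp brA); apply/FU; rewrite (bRS_f brsA).
Qed.

Lemma ble_of_bRS_chains (a b : A) :
  (forall le, is_bRS_chain le -> le a b) -> a ⊑ b.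
Proof.
move=> ab; apply: contrapT; rewrite -(bimp_eq_top brA) -(btop_le brA) => tab.
have [F [primeF Ft Fab]] := prime_filter_separation ordA (bmeetUr brA) tab.
exact: Fab (ab _ (bRS_chain_of_prime_filter primeF Ft)).
Qed.

Lemma eq_of_bRS_chains (a b : A) :
  (forall le, is_bRS_chain le -> chain_eqv le a b) -> a = b.
Proof.
by move=> ab; apply: (lat_le_anti ordA); apply: ble_of_bRS_chains => le chA;
  have [] := ab le chA.
Qed.

End Separation.

(** * Sugihara chains *)

Definition majority (P Q R : Prop) : Prop := P /\ Q \/ P /\ R \/ Q /\ R.

#[local] Instance majority_iff : Proper (iff ==> iff ==> iff ==> iff) majority.
Proof. by move=> P P' + Q Q' + R R' +; rewrite /majority; tauto. Qed.

(* On a chain, the majority law for [smul x y] says that it is the meet of [x]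
   and [y] when [x] lies below [sneg y], and their join otherwise. *)
Record is_Sugihara_chain (S : SM_sig) (le : S -> S -> Prop) : Prop := {
  Sugihara_chain_lattice :> is_lattice_chain (@smeet S) (@sjoin S) le;
  Sugihara_chain_neg : forall x y, le x (sneg y) -> le y (sneg x);
  Sugihara_chain_negK : forall x, le (sneg (sneg x)) x;
  Sugihara_chain_f_t : le (sneg st) st;
  Sugihara_chain_t_f : forall x, le st x \/ le x (sneg st);
  Sugihara_chain_mul : forall x y z,
    le (smul x y) z <-> majority (le x (sneg y)) (le x z) (le y z);
  Sugihara_chain_imp : forall x y z,
    le x (simp y z) <-> majority (le x (sneg y)) (le x z) (le y z)
}.

Section SugiharaChain.

Variables (S : SM_sig) (le : S -> S -> Prop).
Hypothesis chS : is_Sugihara_chain le.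

Local Notation "x ≤ y" := (le x y) (at level 70, no associativity).
Local Notation "x ≡ y" := (chain_eqv le x y) (at level 70, no associativity).
Local Notation "x ⊥ y" := (le x (sneg y)) (at level 70, no associativity).
Local Notation "x · y" := (smul x y) (at level 40, left associativity).

Let refl := chain_refl chS.
Let trans := chain_trans chS.

Lemma perpC (x y : S) : x ⊥ y <-> y ⊥ x.
Proof. by split; exact: (Sugihara_chain_neg chS). Qed.

Lemma chain_negK (x : S) : sneg (sneg x) ≡ x.
Proof. by split; [exact: (Sugihara_chain_negK chS) | exact/perpC]. Qed.

Lemma chain_eqv_perp (x y : S) : (forall z, x ⊥ z <-> y ⊥ z) -> x ≡ y.
Proof.
move=> xy; apply: (chain_eqv_ge chS) => z; have [nnz_z z_nnz] := chain_negK z.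
split=> [xz | yz]; apply: trans nnz_z; apply/xy.
- exact: trans xz z_nnz.
- exact: trans yz z_nnz.
Qed.

Lemma perp_mul (x y z : S) : x · y ⊥ z <-> majority (x ⊥ y) (x ⊥ z) (y ⊥ z).
Proof. exact: (Sugihara_chain_mul chS). Qed.

Lemma perp_ferrers (x y z w : S) : x ⊥ y -> z ⊥ w -> x ⊥ z \/ y ⊥ w.
Proof.
move=> xy zw; have [yz | zy] := chain_total chS y z; [right | left].
- exact: trans yz zw.
- by apply/perpC/(trans zy)/perpC.
Qed.

Lemma Sugihara_chain_mulC (x y : S) : x · y ≡ y · x.
Proof.
by apply: chain_eqv_perp => z; rewrite !perp_mul (perpC x y) /majority; tauto.
Qed.

Lemma Sugihara_chain_mulA (x y z : S) : x · (y · z) ≡ x · y · z.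
Proof.
apply: chain_eqv_perp => w.
rewrite !perp_mul (perpC x (y · z)) !perp_mul (perpC y x) (perpC z x) /majority.
have := @perp_ferrers x y z w; have := @perp_ferrers x y w z.
have := @perp_ferrers x z y w; have := @perp_ferrers x z w y.
have := @perp_ferrers x w y z; have := @perp_ferrers x w z y.
rewrite (perpC w y) (perpC w z) (perpC z y).
tauto.
Qed.

Lemma Sugihara_chain_mul1 (x : S) : x · st ≡ x.
Proof.
apply: chain_eqv_perp => y; rewrite perp_mul /majority.
have perp_t : x ⊥ st -> st ⊥ y -> x ⊥ y.
  move=> xt /perpC yt; apply: trans xt (trans (Sugihara_chain_f_t chS) _).
  exact/perpC.
have perp_cases : x ⊥ y -> x ⊥ st \/ st ⊥ y.
  move=> xy; have [tx | xf] := Sugihara_chain_t_f chS x; last by left.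
  by right; exact: trans tx xy.
by tauto.
Qed.

Lemma Sugihara_chain_mul_idem (x : S) : x · x ≡ x.
Proof. by apply: chain_eqv_perp => y; rewrite perp_mul /majority; tauto. Qed.

Lemma Sugihara_chain_residuation (x y z : S) : x · y ≤ z <-> x ≤ simp y z.
Proof. by rewrite (Sugihara_chain_mul chS) (Sugihara_chain_imp chS). Qed.

Lemma Sugihara_chain_contraposition (x y : S) :
  simp x (sneg y) ≡ simp y (sneg x).
Proof.
apply: (chain_eqv_le chS) => z.
by rewrite !(Sugihara_chain_imp chS) (perpC y x) /majority; tauto.
Qed.

End SugiharaChain.

Section SeparatingChains.

Variables (S : SM_sig) (I : Type) (le : I -> S -> S -> Prop).
Hypothesis chS : forall i, is_Sugihara_chain (le i).
Hypothesis sepS : forall x y, (forall i, chain_eqv (le i) x y) -> x = y.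

Lemma separating_chains_sle (x y : S) : sle x y <-> forall i, le i x y.
Proof.
split=> [xy i | xy]; first exact: (chain_of_meet (chS i)).
by apply: sepS => i; exact: (chain_meet_l (chS i)).
Qed.

Lemma separating_chains_lattice : is_lattice (@smeet S) (@sjoin S).
Proof.
have sep_le x y : (forall i z, le i z x <-> le i z y) -> x = y.
  by move=> xy; apply: sepS => i; exact: (chain_eqv_le (chS i)).
split=> [x y|x y|x y z|x y z|x y|x y]; apply: sep_le => i w;
  by rewrite ?(chain_lexI (chS i), chain_lexU (chS i)); tauto.
Qed.

Lemma is_SM_of_separating_chains : is_SM S.
Proof.
split.
- exact: separating_chains_lattice.
- move=> x y z; apply: sepS => i; apply: (chain_eqv_le (chS i)) => w.
  by rewrite !(chain_lexI (chS i), chain_lexU (chS i)); tauto.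
- by move=> x y z; apply: sepS => i; exact: (Sugihara_chain_mulA (chS i)).
- by move=> x y; apply: sepS => i; exact: (Sugihara_chain_mulC (chS i)).
- by move=> x; apply: sepS => i; exact: (Sugihara_chain_mul1 (chS i)).
- move=> x y z; rewrite !separating_chains_sle.
  by split=> xyz i; apply/(Sugihara_chain_residuation (chS i)).
- by move=> x; apply: sepS => i; exact: (Sugihara_chain_mul_idem (chS i)).
- by move=> x; apply: sepS => i; exact: (chain_negK (chS i)).
- move=> x y; apply: sepS => i.
  exact: (Sugihara_chain_contraposition (chS i)).
Qed.

End SeparatingChains.

(** * The Sugihara monoid of a bRS-algebra *)

Section ChainPairs.

Variables (A : bRS_sig) (le : A -> A -> Prop).
Hypothesis brA : is_Brouwerian A.
Hypothesis chA : is_bRS_chain le.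

Local Notation "a ≼ b" := (le a b) (at level 70, no associativity).
Local Notation "a ≡ b" := (chain_eqv le a b) (at level 70, no associativity).

Let refl := chain_refl chA.
Let trans := chain_trans chA.

#[local] Instance eqv_equivalence : Equivalence (chain_eqv le) :=
  chain_eqv_equivalence chA.
#[local] Instance le_proper :
  Proper (chain_eqv le ==> chain_eqv le ==> iff) le := chain_le_proper chA.
#[local] Instance meet_proper :
  Proper (chain_eqv le ==> chain_eqv le ==> chain_eqv le) (@bmeet A) :=
  chain_meet_proper chA.
#[local] Instance join_proper :
  Proper (chain_eqv le ==> chain_eqv le ==> chain_eqv le) (@bjoin A) :=
  chain_join_proper chA.

#[local] Instance imp_proper :
  Proper (chain_eqv le ==> chain_eqv le ==> chain_eqv le) (@bimp A).
Proof.
move=> a a' aa' b b' bb'; apply: (chain_eqv_le chA) => c.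
by rewrite -!(bRS_chain_imp chA) aa' bb'.
Qed.

#[local] Instance bN_proper : Proper (chain_eqv le ==> chain_eqv le) (@bN A).
Proof. by move=> a a' aa'; rewrite /bN aa'. Qed.

Lemma chain_top_le (a : A) : bt ≼ a <-> a ≡ bt.
Proof. by split=> [ta | []] //; split=> //; exact: (bRS_chain_top chA). Qed.

Lemma chain_imp_top (a b : A) : a ≼ b -> a ⇀ b ≡ bt.
Proof.
by move=> ab; apply/chain_top_le/(bRS_chain_imp chA); rewrite (btmeet brA).
Qed.

Lemma chain_imp_nle (a b : A) : ~ a ≼ b -> a ⇀ b ≡ b.
Proof.
move=> ab; apply: (chain_eqv_le chA) => c.
by rewrite -(bRS_chain_imp chA) (chain_leIx chA); tauto.
Qed.

Lemma chain_imp_bN (a b : A) : a ≼ bf -> a ⇀ bN b ≡ a ⇀ b.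
Proof. by move=> a_f; rewrite /bN -(bimp_curry brA) (chain_meet_l chA a_f). Qed.

Lemma chain_imp_bN_top (a b : A) : a ≼ b -> a ⇀ bN b ≡ bt.
Proof.
move=> ab; apply: chain_imp_top; apply: trans ab _.
exact: (chain_of_meet chA) (ble_imp brA bf b).
Qed.

Definition pair_le (p q : A * A) : Prop := fst p ≼ fst q /\ snd q ≼ snd p.

Definition pair_eqv (p q : A * A) : Prop := fst p ≡ fst q /\ snd p ≡ snd q.

Definition chain_bowtie (p : A * A) : Prop :=
  fst p ≡ bt /\ snd p ≼ bf \/ snd p ≡ bt /\ fst p ≼ bf.

Lemma pair_le_eqvl (p q r : A * A) :
  pair_eqv p q -> pair_le p r <-> pair_le q r.
Proof. by move=> [pq1 pq2]; rewrite /pair_le pq1 pq2. Qed.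

Lemma pair_le_eqvr (p q r : A * A) :
  pair_eqv p q -> pair_le r p <-> pair_le r q.
Proof. by move=> [pq1 pq2]; rewrite /pair_le pq1 pq2. Qed.

Lemma chain_bowtie_eqv (p q : A * A) :
  pair_eqv p q -> chain_bowtie q -> chain_bowtie p.
Proof. by move=> [pq1 pq2]; rewrite /chain_bowtie pq1 pq2. Qed.

Lemma chain_bowtieP (a b : A) :
  chain_bowtie (a, b) <-> bt ≼ a ⊔ b /\ a ⊓ b ≼ bf.
Proof.
rewrite /chain_bowtie /= -!chain_top_le (chain_lexU chA) (chain_leIx chA).
have top_le_f x y : bt ≼ x -> x ≼ bf -> y ≼ bf.
  by move=> tx xf; apply: trans (bRS_chain_top chA y) (trans tx xf).
by have := top_le_f a b; have := top_le_f b a; tauto.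
Qed.

Lemma chain_bowtie_neg (p : A * A) :
  chain_bowtie p -> chain_bowtie (pair_neg p).
Proof. by case: p => a b; rewrite /chain_bowtie /=; tauto. Qed.

Lemma chain_bowtie_meet (p q : A * A) :
  chain_bowtie p -> chain_bowtie q -> chain_bowtie (pair_meet p q).
Proof.
case: p q => [a b] [c d]; rewrite /chain_bowtie /= -!chain_top_le.
rewrite (chain_lexI chA) (chain_leIx chA) (chain_leUx chA) (chain_lexU chA).
by tauto.
Qed.

Lemma chain_bowtie_join (p q : A * A) :
  chain_bowtie p -> chain_bowtie q -> chain_bowtie (pair_join p q).
Proof.
case: p q => [a b] [c d] /chain_bowtie_neg bow_p /chain_bowtie_neg bow_q.
exact: chain_bowtie_neg (chain_bowtie_meet bow_p bow_q).
Qed.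

Lemma pair_le_total (p q : A * A) :
  chain_bowtie p -> chain_bowtie q -> pair_le p q \/ pair_le q p.
Proof.
case: p q => [a b] [c d]; rewrite /chain_bowtie /pair_le /=.
move=> [[-> _] | [-> a_f]] [[-> _] | [-> c_f]].
- by have := chain_total chA b d; have := refl bt; tauto.
- by right; split; exact: (bRS_chain_top chA).
- by left; split; exact: (bRS_chain_top chA).
- by have := chain_total chA a c; have := refl bt; tauto.
Qed.

Lemma chain_bowtie_neg_imp (a b : A) :
  chain_bowtie (a, b) -> a ≼ b -> a ⇀ bf ≡ b.
Proof.
case=> /= [[a_t b_f] ab | [-> a_f] _]; last exact: chain_imp_top.
rewrite (chain_imp_top (trans ab b_f)); symmetry.
by apply/chain_top_le; rewrite -a_t.
Qed.

Let latA := Brouwerian_lattice brA.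
Let topE :=
  (btmeet brA, bmeett brA, btjoin brA, bjoint brA, btimp brA, bimpt brA).

Lemma pair_mul_perp (p q : A * A) : chain_bowtie p -> chain_bowtie q ->
  pair_le p (pair_neg q) -> pair_eqv (pair_mul p q) (pair_meet p q).
Proof.
case: p q => [a b] [c d] bow_p bow_q [/= ad cb].
have := chain_bowtie_meet bow_p bow_q; rewrite /pair_eqv /pair_mul /= => bow_pq.
rewrite (chain_imp_bN_top ad) (chain_imp_bN_top cb) /bN !topE.
split; first by [].
apply: chain_bowtie_neg_imp bow_pq _.
by rewrite (chain_leIx chA) !(chain_lexU chA); tauto.
Qed.

Lemma pair_mulC (p q : A * A) : pair_mul p q = pair_mul q p.
Proof.
case: p q => [a b] [c d]; rewrite /pair_mul /=.
by rewrite (meetC latA a c) (meetC latA (a ⇀ _)).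
Qed.

Lemma pair_joinC (p q : A * A) : pair_join p q = pair_join q p.
Proof.
by case: p q => [a b] [c d] /=; rewrite (joinC latA a) (meetC latA b).
Qed.

Lemma pair_mul_nperp_mixed (a b c d : A) :
  a ≡ bt -> b ≼ bf -> d ≡ bt -> c ≼ bf -> ~ c ≼ b ->
  pair_eqv (pair_mul (a, b) (c, d)) (pair_join (a, b) (c, d)).
Proof.
rewrite /pair_eqv /pair_mul /= => a_t b_f d_t c_f n_cb.
rewrite a_t d_t (chain_imp_bN b c_f) (chain_imp_nle n_cb) /bN !topE.
rewrite (chain_imp_top (chain_nle chA n_cb)) !topE; split; first by [].
by rewrite (bimp_meet brA) (chain_meet_l chA b_f).
Qed.

Lemma pair_mul_nperp (p q : A * A) : chain_bowtie p -> chain_bowtie q ->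
  ~ pair_le p (pair_neg q) -> pair_eqv (pair_mul p q) (pair_join p q).
Proof.
case: p q => [a b] [c d]; rewrite /chain_bowtie /pair_le /=.
move=> [[a_t b_f] | [b_t a_f]] [[c_t d_f] | [d_t c_f]] nperp.
- rewrite /pair_eqv /pair_mul /= a_t c_t !topE; split; first by [].
  rewrite /bN -(bimpI brA) !(bimp_meet brA) (meetC latA b).
  by apply: (chain_meet_l chA); apply/(chain_leIx chA); left.
- by apply: pair_mul_nperp_mixed => // cb; apply: nperp; rewrite a_t d_t; split.
- rewrite pair_mulC -/(pair_join (a, b) (c, d)) pair_joinC.
  by apply: pair_mul_nperp_mixed => // ad; apply: nperp; rewrite b_t c_t; split.
- by case: nperp; rewrite b_t d_t; split; exact: (bRS_chain_top chA).
Qed.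

Lemma bN_imp_bN (a b : A) : bN a ⇀ bN b = a ⇀ bN b.
Proof. by rewrite /bN -!(bimp_curry brA) (bimp_meet brA). Qed.

Lemma pair_imp_le (p q : A * A) : chain_bowtie p -> chain_bowtie q ->
  pair_le p q -> pair_eqv (pair_imp p q) (pair_join (pair_neg p) q).
Proof.
case: p q => [a b] [c d] bow_p bow_q [/= ac db].
have := chain_bowtie_join (chain_bowtie_neg bow_p) bow_q.
rewrite /pair_eqv /pair_imp /= => bow_pq.
rewrite bN_imp_bN (chain_imp_top ac) (chain_imp_bN_top db) !topE /bN.
rewrite (bimp_meet brA) -(meetA latA) (bimp_meet brA) (meetA latA).
have [bc_t ad_f] : bt ≼ b ⊔ c /\ a ⊓ d ≼ bf.
  case: bow_pq => /= [[-> //] | [/chain_top_le/(chain_lexI chA) [ta _] bc_f]].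
  have bc_t : bt ≼ b ⊔ c by apply/(chain_lexU chA); right; exact: trans ta ac.
  by split=> //; apply: trans (trans (bRS_chain_top chA _) bc_t) bc_f.
by split; [symmetry; exact/chain_top_le | exact: (chain_meet_l chA)].
Qed.

Lemma pair_imp_nle (p q : A * A) : chain_bowtie p -> chain_bowtie q ->
  ~ pair_le p q -> pair_eqv (pair_imp p q) (pair_meet (pair_neg p) q).
Proof.
case: p q => [a b] [c d].
rewrite /chain_bowtie /pair_le /pair_eqv /pair_imp /= bN_imp_bN.
move=> [[a_t b_f] | [b_t a_f]] [[c_t d_f] | [d_t c_f]] nle.
- have n_db : ~ d ≼ b by move=> db; apply: nle; rewrite a_t c_t; split.
  rewrite a_t c_t (chain_imp_bN b d_f) (chain_imp_nle n_db) !topE.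
  rewrite (chain_imp_bN_top (chain_nle chA n_db)) (chain_imp_top b_f).
  by rewrite /bN !topE.
- have meet_bN : c ⊓ bN b ≡ b ⊓ c.
    rewrite -{1}(chain_meet_l chA c_f) -(meetA latA) (bmeet_imp brA).
    by rewrite (meetA latA) (chain_meet_l chA c_f) (meetC latA).
  rewrite a_t d_t /bN !topE -/(bN b) meet_bN; split; first by [].
  by apply: chain_imp_top; apply/(chain_leIx chA); right.
- by case: nle; rewrite b_t c_t; split; exact: (bRS_chain_top chA).
- have n_ac : ~ a ≼ c by move=> ac; apply: nle; rewrite b_t d_t; split.
  rewrite b_t d_t (chain_imp_nle n_ac) /bN !topE.
  by rewrite (chain_imp_top (chain_nle chA n_ac)) (chain_imp_top c_f) !topE.
Qed.

Lemma chain_bowtie_mul (p q : A * A) :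
  chain_bowtie p -> chain_bowtie q -> chain_bowtie (pair_mul p q).
Proof.
move=> bow_p bow_q; have [pq | pq] := EM (pair_le p (pair_neg q)).
- apply: (chain_bowtie_eqv (pair_mul_perp bow_p bow_q pq)).
  exact: chain_bowtie_meet.
- apply: (chain_bowtie_eqv (pair_mul_nperp bow_p bow_q pq)).
  exact: chain_bowtie_join.
Qed.

Lemma chain_bowtie_imp (p q : A * A) :
  chain_bowtie p -> chain_bowtie q -> chain_bowtie (pair_imp p q).
Proof.
move=> bow_p bow_q; have bow_np := chain_bowtie_neg bow_p.
have [pq | pq] := EM (pair_le p q).
- apply: (chain_bowtie_eqv (pair_imp_le bow_p bow_q pq)).
  exact: chain_bowtie_join.
- apply: (chain_bowtie_eqv (pair_imp_nle bow_p bow_q pq)).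
  exact: chain_bowtie_meet.
Qed.

End ChainPairs.

Section Bowtie.

Variable A : bRS_sig.
Hypothesis brsA : is_bRS A.

Let brA := relative_Stone_Brouwerian (bRS_relative_Stone brsA).

Lemma in_bowtieP (p : A * A) :
  in_bowtie p <-> forall le, is_bRS_chain le -> chain_bowtie le p.
Proof.
case: p => a b; split=> [[ab_t ab_f] le chA | chab].
  apply/(chain_bowtieP chA); rewrite ab_t; split; first exact: (chain_refl chA).
  exact: (chain_of_meet chA).
split.
- apply/(btop_le brA)/(ble_of_bRS_chains brsA) => le chA.
  by have /(chain_bowtieP chA) [] := chab le chA.
- apply: (ble_of_bRS_chains brsA) => le chA.
  by have /(chain_bowtieP chA) [] := chab le chA.
Qed.

Lemma pair_eq_of_bRS_chains (p q : A * A) :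
  (forall le, is_bRS_chain le -> pair_eqv le p q) -> p = q.
Proof.
case: p q => [a b] [c d] pq.
by congr pair; apply: (eq_of_bRS_chains brsA) => le /pq [].
Qed.

Lemma bowtie_closed : upper_closed A.
Proof.
split=> [p q | p q | p q | p q | | p]; rewrite !in_bowtieP.
- by move=> bow_p bow_q le chA; apply: (chain_bowtie_meet chA); auto.
- by move=> bow_p bow_q le chA; apply: (chain_bowtie_join chA); auto.
- by move=> bow_p bow_q le chA; apply: (chain_bowtie_mul brA chA); auto.
- by move=> bow_p bow_q le chA; apply: (chain_bowtie_imp brA chA); auto.
- by move=> le chA; left; split; [split|]; exact: (chain_refl chA).
- by move=> bow_p le chA; apply: chain_bowtie_neg; auto.
Qed.

Variable upA : upper_closed A.

Section Chain.

Variable le : A -> A -> Prop.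
Hypothesis chA : is_bRS_chain le.

Definition bowtie_le (u v : upper_sig upA) : Prop :=
  pair_le le (proj1_sig u) (proj1_sig v).

Lemma chain_bowtie_val (u : upper_sig upA) : chain_bowtie le (proj1_sig u).
Proof. by case: u => p bow_p; exact: (proj1 (in_bowtieP p)). Qed.

Lemma bowtie_lattice_chain :
  is_lattice_chain (@smeet (upper_sig upA)) (@sjoin (upper_sig upA)) bowtie_le.
Proof.
split.
- by move=> u; split; exact: (chain_refl chA).
- move=> u v w [uv vu] [vw wv].
  by split; [exact: (chain_trans chA) uv vw | exact: (chain_trans chA) wv vu].
- by move=> u v; apply: (pair_le_total chA); exact: chain_bowtie_val.
- move=> [[a a'] ?] [[b b'] ?] [[d d'] ?]; rewrite /bowtie_le /pair_le /=.
  by rewrite (chain_lexI chA) (chain_leUx chA); tauto.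
- move=> [[a a'] ?] [[b b'] ?] [[d d'] ?]; rewrite /bowtie_le /pair_le /=.
  by rewrite (chain_lexI chA) (chain_leUx chA); tauto.
Qed.

Lemma bowtie_leC (u v : upper_sig upA) :
  bowtie_le u (sneg v) -> bowtie_le v (sneg u).
Proof. by case: u v => [[a a'] ?] [[b b'] ?] [] /=; split. Qed.

Lemma bowtie_le_mul (u v w : upper_sig upA) : bowtie_le (smul u v) w <->
  majority (bowtie_le u (sneg v)) (bowtie_le u w) (bowtie_le v w).
Proof.
have [bow_u bow_v] := (chain_bowtie_val u, chain_bowtie_val v).
have [uv | uv] := EM (bowtie_le u (sneg v)).
- have -> : bowtie_le (smul u v) w <-> bowtie_le (smeet u v) w.
    exact: pair_le_eqvl (pair_mul_perp brA chA bow_u bow_v uv).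
  by rewrite (chain_leIx bowtie_lattice_chain) /majority; tauto.
- have -> : bowtie_le (smul u v) w <-> bowtie_le (sjoin u v) w.
    exact: pair_le_eqvl (pair_mul_nperp brA chA bow_u bow_v uv).
  by rewrite (chain_leUx bowtie_lattice_chain) /majority; tauto.
Qed.

Lemma bowtie_le_imp (u v w : upper_sig upA) : bowtie_le u (simp v w) <->
  majority (bowtie_le u (sneg v)) (bowtie_le u w) (bowtie_le v w).
Proof.
have [bow_v bow_w] := (chain_bowtie_val v, chain_bowtie_val w).
have [vw | vw] := EM (bowtie_le v w).
- have -> : bowtie_le u (simp v w) <-> bowtie_le u (sjoin (sneg v) w).
    exact: pair_le_eqvr (pair_imp_le brA chA bow_v bow_w vw).
  by rewrite (chain_lexU bowtie_lattice_chain) /majority; tauto.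
- have -> : bowtie_le u (simp v w) <-> bowtie_le u (smeet (sneg v) w).
    exact: pair_le_eqvr (pair_imp_nle brA chA bow_v bow_w vw).
  by rewrite (chain_lexI bowtie_lattice_chain) /majority; tauto.
Qed.

Lemma bowtie_Sugihara_chain : is_Sugihara_chain bowtie_le.
Proof.
split.
- exact: bowtie_lattice_chain.
- exact: bowtie_leC.
- by case=> [[a b] ?]; split; exact: (chain_refl chA).
- by split; exact: (bRS_chain_top chA).
- move=> u; have := chain_bowtie_val u; case: u => [[a b] ?].
  rewrite /chain_bowtie /bowtie_le /pair_le /=.
  by move=> [[[_ t_a] b_f] | [[_ t_b] a_f]]; [left | right].
- exact: bowtie_le_mul.
- exact: bowtie_le_imp.
Qed.

End Chain.

Lemma bowtie_SM : is_SM (upper_sig upA).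
Proof.
pose chain := {le : A -> A -> Prop | is_bRS_chain le}.
apply: (@is_SM_of_separating_chains _ chain
  (fun le => bowtie_le (proj1_sig le))).
- by move=> [le chA]; exact: bowtie_Sugihara_chain.
- move=> u v uv; apply: sig_val_inj; apply: pair_eq_of_bRS_chains => le chA.
  by have [[? ?] [? ?]] := uv (exist _ le chA).
Qed.

End Bowtie.

Section BowtieMap.

Variables (A B : bRS_sig) (h : A -> B).
Hypothesis homh : is_bRS_hom h.

Lemma pair_map_bowtie (p : A * A) : in_bowtie p -> in_bowtie (pair_map h p).
Proof.
case: p => a b [ab_t ab_f]; split.
  by rewrite -(bRS_hom_join homh) ab_t (bRS_hom_t homh).
by rewrite /ble -(bRS_hom_f homh) -!(bRS_hom_meet homh) ab_f.
Qed.

Lemma pair_map_SM_hom (upA : upper_closed A) (upB : upper_closed B)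
    (h_closed : forall p : A * A, in_bowtie p -> in_bowtie (pair_map h p)) :
  @is_SM_hom (upper_sig upA) (upper_sig upB) (restrict h_closed).
Proof.
pose homE := (bRS_hom_meet homh, bRS_hom_join homh, bRS_hom_imp homh,
              bRS_hom_t homh, bRS_hom_f homh).
split; [move=> [[a b] ?] [[d e] ?] .. | | move=> [[a b] ?]];
  by apply: sig_val_inj; rewrite /= /pair_mul /pair_imp /= /bN ?homE.
Qed.

End BowtieMap.

Lemma bowtie_upper_well_defined : upper_well_defined.
Proof.
exists (fun A => bowtie_closed (bRS_axioms A))
       (fun A B h => pair_map_bowtie (bRS_funP h)).
- by move=> A; exact: bowtie_SM (bRS_axioms A) _.
- by move=> A B h; exact: pair_map_SM_hom (bRS_funP h) _ _ _.
Qed.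

(** * Sugihara monoids *)

Declare Scope SM_scope.
Delimit Scope SM_scope with SM.
Local Notation "x ∧ y" := (smeet x y)
  (at level 40, left associativity) : SM_scope.
Local Notation "x ∨ y" := (sjoin x y)
  (at level 50, left associativity) : SM_scope.
Local Notation "x · y" := (smul x y)
  (at level 40, left associativity) : SM_scope.
Local Notation "x ≤ y" := (sle x y)
  (at level 70, no associativity) : SM_scope.
Local Notation "¬ x" := (sneg x)
  (at level 35, right associativity) : SM_scope.
Local Open Scope SM_scope.

Lemma sle_lattice_order (S : SM_sig) :
  is_SM S -> is_lattice_order (@smeet S) (@sjoin S) (@sle S).
Proof. by move=> smS; split; first exact: SM_lattice. Qed.

Section Sugihara.

Variable S : SM_sig.
Hypothesis smS : is_SM S.

Let latS := SM_lattice smS.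
Let ordS := sle_lattice_order smS.
Let mulA := SM_mulA smS.
Let mulC := SM_mulC smS.
Let negK := SM_negK smS.
Let lexx := lat_lexx ordS.
Let leIl := lat_leIl ordS.
Let leIr := lat_leIr ordS.
Let le_trans := lat_le_trans ordS.

Lemma simpP (x y z : S) : x · y ≤ z <-> x ≤ simp y z.
Proof. exact: (SM_residuation smS). Qed.

Lemma smul_le2 (x y z w : S) : x ≤ z -> y ≤ w -> x · y ≤ z · w.
Proof.
have mul_le2l (a b d : S) : a ≤ b -> a · d ≤ b · d.
  move=> ab; rewrite simpP; apply: le_trans ab _.
  by rewrite -simpP; exact: lexx.
move=> xz yw; apply: (le_trans (y := z · y)); first exact: mul_le2l.
by rewrite !(mulC z); exact: mul_le2l.
Qed.

Lemma stmul (x : S) : st · x = x.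
Proof. by rewrite mulC (SM_mul1 smS). Qed.

Lemma smulKl (x y : S) : x · (x · y) = x · y.
Proof. by rewrite mulA (SM_mul_idem smS). Qed.

Lemma smulKr (x y : S) : x · y · x = x · y.
Proof. by rewrite mulC smulKl. Qed.

Lemma smul_mull (x y z : S) : x · (y · z) = (x · y) · (x · z).
Proof. by rewrite (mulA (x · y)) smulKr mulA. Qed.

Lemma smul_le_r (u x : S) : u ≤ st -> u · x ≤ x.
Proof. by move=> ut; rewrite -{2}(stmul x); exact: smul_le2. Qed.

Lemma smul_le_l (u x : S) : x ≤ st -> u · x ≤ u.
Proof. by rewrite mulC; exact: smul_le_r. Qed.

Lemma smeet_le_mul (x y : S) : x ∧ y ≤ x · y.
Proof. by rewrite -(SM_mul_idem smS (x ∧ y)); exact: smul_le2. Qed.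

Lemma smul_neg_cone (x y : S) : x ≤ st -> y ≤ st -> x · y = x ∧ y.
Proof.
move=> xt yt; apply: (lat_le_anti ordS); last exact: smeet_le_mul.
by apply/(lat_lexI ordS); split; [exact: smul_le_l | exact: smul_le_r].
Qed.

Lemma simp_f (x : S) : simp x (¬ st) = ¬ x.
Proof.
rewrite (SM_contraposition smS); apply: (lat_eq_le ordS) => y.
by rewrite -simpP (SM_mul1 smS).
Qed.

Lemma sle_neg (x y : S) : x ≤ ¬ y <-> x · y ≤ ¬ st.
Proof. by rewrite simpP simp_f. Qed.

Lemma sle_mul_neg (x y : S) : x ≤ y <-> x · ¬ y ≤ ¬ st.
Proof. by rewrite -sle_neg negK. Qed.

Lemma smul_neg_le (x : S) : x · ¬ x ≤ ¬ st.
Proof. by rewrite -sle_mul_neg; exact: lexx. Qed.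

Lemma sneg_st_le : ¬ (@st S) ≤ st.
Proof. by rewrite sle_mul_neg (SM_mul_idem smS); exact: lexx. Qed.

Lemma sneg_le (x y : S) : ¬ x ≤ ¬ y <-> y ≤ x.
Proof. by rewrite sle_neg (sle_mul_neg y) mulC. Qed.

Lemma simpE (x y : S) : simp x y = ¬ (x · ¬ y).
Proof.
apply: (lat_eq_le ordS) => z; rewrite -simpP sle_neg mulA; exact: sle_mul_neg.
Qed.

Lemma snegU (x y : S) : ¬ (x ∨ y) = ¬ x ∧ ¬ y.
Proof.
apply: (lat_eq_le ordS) => z; rewrite (lat_lexI ordS) -(negK z) !sneg_le.
exact: (lat_leUx ordS).
Qed.

Lemma snegI (x y : S) : ¬ (x ∧ y) = ¬ x ∨ ¬ y.
Proof. by rewrite -{1}(negK x) -{1}(negK y) -snegU negK. Qed.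

Lemma st_le_excluded_middle (x : S) : st ≤ x ∨ ¬ x.
Proof.
apply/sneg_le; rewrite snegU negK (meetC latS).
exact: le_trans (smeet_le_mul _ _) (smul_neg_le _).
Qed.

(* [¬ (simp x y) = x · ¬ y] lies below [simp y x], because [y · ¬ y ≤ st]. *)
Lemma st_le_simpU (x y : S) : st ≤ simp x y ∨ simp y x.
Proof.
apply: le_trans (st_le_excluded_middle (simp x y)) _.
apply: (lat_leU2 ordS); first exact: lexx.
rewrite simpE negK -simpP -mulA mulC; apply: smul_le_r.
by rewrite mulC; exact: le_trans (smul_neg_le y) sneg_st_le.
Qed.

Lemma neg_cone_cover (x y : S) : st ≤ x ∨ y -> (x ∧ st) ∨ (y ∧ st) = st.
Proof.
move=> xy; rewrite !(meetC latS _ st) -(SM_distributive smS).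
exact/(lat_leE ordS).
Qed.

Lemma neg_cone_closed : lower_closed S.
Proof.
rewrite /in_neg_cone; split=> [x y xt _ | x y xt yt | x y _ _ | |].
- exact: le_trans (leIl _ _) xt.
- exact/(lat_leUx ordS).
- exact: leIr.
- exact: lexx.
- exact: sneg_st_le.
Qed.

Lemma le_neg_imp (u x y : S) : u ≤ neg_imp x y <-> u ≤ st /\ u · x ≤ y.
Proof. by rewrite simpP (lat_lexI ordS); tauto. Qed.

Section NegCone.

Variable lowS : lower_closed S.

Lemma ble_sle (u v : lower_sig lowS) :
  (u ⊑ v)%bRS <-> proj1_sig u ≤ proj1_sig v.
Proof.
by split=> [/(f_equal (@proj1_sig _ _)) | uv] //; exact: sig_val_inj.
Qed.

Lemma neg_cone_bRS : is_bRS (lower_sig lowS).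
Proof.
split; [split; [split|]|].
- by split=> *; apply: sig_val_inj; apply latS.
- by move=> [x xt]; apply/ble_sle.
- move=> [x xt] [y yt] [z zt]; rewrite !ble_sle /= le_neg_imp smul_neg_cone //.
  by tauto.
- move=> [x xt] [y yt]; apply: sig_val_inj.
  exact: neg_cone_cover (st_le_simpU x y).
- move=> [x xt]; apply: sig_val_inj; rewrite /= /neg_imp simp_f -{1}xt.
  exact: neg_cone_cover (st_le_excluded_middle x).
Qed.

End NegCone.

Lemma neg_cone_cases (x y u z : S) : st ≤ x ∨ y -> u ≤ st ->
  (forall v, v ≤ st -> v ≤ u -> v ≤ x -> v ≤ z) ->
  (forall v, v ≤ st -> v ≤ u -> v ≤ y -> v ≤ z) -> u ≤ z.
Proof.
move=> xy ut xz yz; have uu := le_trans ut xy.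
have -> : u = (u ∧ x) ∨ (u ∧ y) by rewrite -(SM_distributive smS); symmetry.
by apply/(lat_leUx ordS); split; [apply: xz | apply: yz] => //;
  exact: le_trans (leIl _ _) ut.
Qed.

Definition smajority (x y z : S) : S := (x ∧ y) ∨ ((x ∧ z) ∨ (y ∧ z)).

Lemma smajority_le (x y z w : S) : smajority x y z ≤ w <->
  [/\ x ∧ y ≤ w, x ∧ z ≤ w & y ∧ z ≤ w].
Proof. by rewrite !(lat_leUx ordS); split=> [[? []] | []]. Qed.

Lemma smulAC (x y z : S) : x · y · z = x · z · y.
Proof. by rewrite -!mulA (mulC y). Qed.

Lemma sle_neg_mul (u x y : S) : u ≤ ¬ (x · y) <-> u · x ≤ ¬ y.
Proof. by rewrite (sle_neg u) (sle_neg (u · x)) mulA. Qed.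

Lemma le_neg_impI (u x y z w : S) :
  u ≤ neg_imp x y ∧ neg_imp z w <-> [/\ u ≤ st, u · x ≤ y & u · z ≤ w].
Proof. by rewrite (lat_lexI ordS) !le_neg_imp; split=> [[[? ?] []] | []]. Qed.

Lemma neg_imp_mul_ge (x y z : S) :
  smajority (neg_imp x (¬ y)) (neg_imp x z) (neg_imp y z) ≤ neg_imp (x · y) z.
Proof.
have z_absorbs v : v ≤ ¬ (x · y) -> z · (v · (x · y)) ≤ z.
  move=> /sle_neg vxy; apply: smul_le_l; exact: le_trans vxy sneg_st_le.
apply/smajority_le; split; set v := _ ∧ _; apply/le_neg_imp.
all: have /le_neg_impI [vt v_l v_r] := lexx v; split=> //.
- rewrite -(smulKl x y) smul_mull; apply: le_trans (smul_le2 v_r (lexx _)) _.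
  exact/z_absorbs/sle_neg_mul.
- rewrite (mulC x y) -(smulKl y x) (mulC y x) smul_mull.
  apply: le_trans (smul_le2 v_r (lexx _)) _; exact/z_absorbs/sle_neg_mul.
- by rewrite smul_mull -(SM_mul_idem smS z); exact: smul_le2.
Qed.

Lemma neg_imp_mul_le (x y z : S) : neg_imp (x · y) z ≤
  smajority (neg_imp x (¬ y)) (neg_imp x z) (neg_imp y z).
Proof.
set m := smajority _ _ _.
have /smajority_le [perp_x_m perp_y_m x_y_m] := lexx m.
have /le_neg_imp [] := lexx (neg_imp (x · y) z); set u := neg_imp _ _ => ut uxy.
have below v : v ≤ u -> v · (x · y) ≤ z.
  by move=> vu; apply: le_trans uxy; exact: smul_le2.
apply: (neg_cone_cases (st_le_excluded_middle (x · y))) => // v vt vu v_xy.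
  apply: le_trans x_y_m; apply/le_neg_impI; split=> //.
  - rewrite -smulKl; apply: le_trans (below v vu).
    by apply: smul_le2 => //; rewrite -(smulKr x y); exact: smul_le2.
  - rewrite -smulKl; apply: le_trans (below v vu); apply: smul_le2 => //.
    by rewrite -{2}(SM_mul_idem smS y) mulA; exact: smul_le2.
apply: (neg_cone_cases (st_le_excluded_middle (x · ¬ z))) => // w wt wv w_xz.
all: have w_xy : w · x ≤ ¬ y by apply/sle_neg_mul/(le_trans wv).
- apply: le_trans perp_y_m; apply/le_neg_impI; split=> //; rewrite sle_mul_neg.
  have wyz : w · y · ¬ z ≤ x · y · ¬ z.
    rewrite -{2}(SM_mul_idem smS (¬ z)) mulA (smulAC x).
    by apply: smul_le2 (lexx _); exact: smul_le2.
  have -> : w · y · ¬ z = w · (w · y · ¬ z) by rewrite !mulA (SM_mul_idem smS).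
  apply: le_trans (smul_le2 (lexx w) wyz) _; rewrite mulA.
  apply: le_trans (smul_neg_le z); apply: smul_le2 (lexx _).
  exact: below (le_trans wv vu).
- apply: le_trans perp_x_m; apply/le_neg_impI; split=> //.
  by move: w_xz; rewrite sle_neg_mul negK.
Qed.

Lemma smul_le_of_meet (u v x y : S) :
  v ≤ st -> v ≤ u -> v ≤ ¬ x -> u ∧ x ≤ y -> v · x ≤ y.
Proof.
move=> vt vu vx uxy; apply: le_trans uxy; apply/(lat_lexI ordS).
split; last exact: smul_le_r.
have vxt : v · x ≤ st by apply: le_trans sneg_st_le; rewrite -sle_neg.
by rewrite -smulKl; apply: le_trans vu; exact: smul_le_l.
Qed.

Lemma le_neg_imp_lattice (u x y : S) :
  u ≤ neg_imp x y <-> [/\ u ≤ st, u ∧ x ≤ y & u ∧ ¬ y ≤ ¬ x].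
Proof.
have contra (v a b : S) : v · a ≤ b <-> v · ¬ b ≤ ¬ a.
  by rewrite (sle_mul_neg (v · a)) (sle_neg (v · ¬ b)) smulAC.
split=> [/le_neg_imp [ut ux] | [ut ux uy]].
  split=> //; apply: le_trans (smeet_le_mul _ _) _; first exact: ux.
  by rewrite -contra.
apply: (neg_cone_cases (st_le_excluded_middle x)) => // v vt vu vx.
all: apply/le_neg_imp; split=> //.
- apply/contra; apply: (smul_le_of_meet vt vu) uy; rewrite negK.
  apply: le_trans ux; exact/(lat_lexI ordS).
- exact: smul_le_of_meet vt vu vx ux.
Qed.

Lemma sle_lattice (x y : S) : x ≤ y <-> st ∧ x ≤ y /\ st ∧ ¬ y ≤ ¬ x.
Proof.
have := le_neg_imp_lattice st x y; rewrite le_neg_imp stmul => stP.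
split=> [xy | [st_x st_y]]; first by have [] := proj1 stP (conj (lexx st) xy).
by have [] := proj2 stP (And3 (lexx st) st_x st_y).
Qed.

Lemma smul_le_majority (x y z : S) : x · y ≤ z <->
  st ≤ smajority (neg_imp x (¬ y)) (neg_imp x z) (neg_imp y z).
Proof.
have <- : neg_imp (x · y) z =
    smajority (neg_imp x (¬ y)) (neg_imp x z) (neg_imp y z).
  exact: (lat_le_anti ordS) (neg_imp_mul_le x y z) (neg_imp_mul_ge x y z).
by rewrite le_neg_imp stmul; split=> [| []] //; split=> //; exact: lexx.
Qed.

End Sugihara.

Section LatticeIsomorphism.

Variables (S T : SM_sig) (h : S -> T) (g : T -> S).
Hypotheses (smS : is_SM S) (smT : is_SM T).
Hypotheses (hK : cancel h g) (gK : cancel g h).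
Hypothesis h_meet : forall x y, h (x ∧ y) = h x ∧ h y.
Hypothesis h_join : forall x y, h (x ∨ y) = h x ∨ h y.
Hypothesis h_neg : forall x, h (¬ x) = ¬ h x.
Hypothesis h_st : h st = st.

Let ordT := sle_lattice_order smT.

Lemma lattice_iso_sle (x y : S) : h x ≤ h y <-> x ≤ y.
Proof. by rewrite /sle -h_meet; split=> [/(can_inj hK) | ->]. Qed.

Lemma lattice_iso_neg_imp (x y : S) : h (neg_imp x y) = neg_imp (h x) (h y).
Proof.
apply: (lat_eq_le ordT) => w; rewrite -(gK w) lattice_iso_sle.
rewrite (le_neg_imp_lattice smS) (le_neg_imp_lattice smT).
rewrite -!h_neg -h_st -!h_meet.
by split=> -[? ? ?]; split; apply/lattice_iso_sle.
Qed.

Lemma lattice_iso_mul (x y : S) : h (x · y) = h x · h y.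
Proof.
apply: (lat_eq_ge ordT) => w; rewrite -(gK w) lattice_iso_sle.
rewrite (smul_le_majority smS) (smul_le_majority smT).
rewrite -h_neg -!lattice_iso_neg_imp.
by rewrite /smajority -!h_meet -!h_join -h_st lattice_iso_sle.
Qed.

Lemma SM_hom_of_lattice_iso : is_SM_hom h.
Proof.
split=> // [|x y]; first exact: lattice_iso_mul.
by rewrite (simpE smS) (simpE smT) h_neg lattice_iso_mul h_neg.
Qed.

End LatticeIsomorphism.

Section SMHom.

Variables (S T : SM_sig) (h : S -> T).
Hypothesis homh : is_SM_hom h.

Lemma SM_hom_neg_cone (x : S) : in_neg_cone x -> in_neg_cone (h x).
Proof.
by rewrite /in_neg_cone /sle -(SM_hom_t homh) -(SM_hom_meet homh) => ->.
Qed.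

Lemma restrict_bRS_hom (lowS : lower_closed S) (lowT : lower_closed T)
    (h_closed : forall x : S, in_neg_cone x -> in_neg_cone (h x)) :
  @is_bRS_hom (lower_sig lowS) (lower_sig lowT) (restrict h_closed).
Proof.
pose homE := (SM_hom_meet homh, SM_hom_join homh, SM_hom_imp homh,
              SM_hom_t homh, SM_hom_neg homh).
by split=> *; apply: sig_val_inj; rewrite /= /neg_imp ?homE.
Qed.

End SMHom.

Lemma bowtie_lower_well_defined : lower_well_defined.
Proof.
exists (fun S => neg_cone_closed (SM_axioms S))
       (fun S T h => SM_hom_neg_cone (SM_funP h)).
- by move=> S; exact: neg_cone_bRS (SM_axioms S) _.
- by move=> S T h; exact: restrict_bRS_hom (SM_funP h) _ _ _.
Qed.

(** * The equivalence *)

Lemma SM_hom_inverse (S T : SM_sig) (h : S -> T) (g : T -> S) :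
  cancel h g -> cancel g h -> is_SM_hom h -> is_SM_hom g.
Proof.
move=> hK gK [hI hU hM hi h1 hN].
by split=> *; apply: (can_inj hK); rewrite ?hI ?hU ?hM ?hi ?h1 ?hN !gK.
Qed.

Lemma bRS_hom_inverse (A B : bRS_sig) (h : A -> B) (g : B -> A) :
  cancel h g -> cancel g h -> is_bRS_hom h -> is_bRS_hom g.
Proof.
move=> hK gK [hI hU hi h1 hf].
by split=> *; apply: (can_inj hK); rewrite ?hI ?hU ?hi ?h1 ?hf !gK.
Qed.

Lemma SM_is_iso (S T : SM) (h : hom S T) (g : T -> S) :
  cancel (SM_fun h) g -> cancel g (SM_fun h) -> is_iso h.
Proof.
move=> hK gK; exists (SMHom (SM_hom_inverse hK gK (SM_funP h))).
by split; apply: SM_hom_eq; apply: funext; [exact: hK | exact: gK].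
Qed.

Lemma bRS_is_iso (A B : bRSA) (h : hom A B) (g : B -> A) :
  cancel (bRS_fun h) g -> cancel g (bRS_fun h) -> is_iso h.
Proof.
move=> hK gK; exists (BRSHom (bRS_hom_inverse hK gK (bRS_funP h))).
by split; apply: bRS_hom_eq; apply: funext; [exact: hK | exact: gK].
Qed.

Section ConePair.

Variable S : SM_sig.
Hypothesis smS : is_SM S.

Let latS := SM_lattice smS.
Let ordS := sle_lattice_order smS.
Let lexx := lat_lexx ordS.
Let leIl := lat_leIl ordS.
Let leIr := lat_leIr ordS.
Let le_trans := lat_le_trans ordS.

Section Glue.

Variables a b : S.
Hypotheses (a_t : a ≤ st) (b_t : b ≤ st).
Hypotheses (st_ab : st ≤ a ∨ b) (ab_f : a ∧ b ≤ ¬ st).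

Lemma glue_meet_st : (a · ¬ b) ∧ st = a.
Proof.
apply: (lat_le_anti ordS).
  apply: (neg_cone_cases smS st_ab (leIr _ _)) => v vt v_glue v_b //.
  rewrite -(SM_mul_idem smS v).
  apply: le_trans (smul_le2 smS (le_trans v_glue (leIl _ _)) v_b) _.
  rewrite -(SM_mulA smS) (SM_mulC smS (¬ b)); apply: (smul_le_l smS).
  exact: le_trans (smul_neg_le smS b) (sneg_st_le smS).
apply/(lat_lexI ordS); split=> //; rewrite -{1}(SM_mul_idem smS a).
by apply: (smul_le2 smS) => //; rewrite (sle_neg smS) smul_neg_cone.
Qed.

Lemma neg_glue_meet_st : ¬ (a · ¬ b) ∧ st = b.
Proof.
rewrite -(simpE smS); apply: (lat_le_anti ordS); last first.
  by apply/(le_neg_imp smS); split=> //; exact: smul_le_l.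
have /(le_neg_imp smS) [ut ua] := lexx (neg_imp a b).
apply: (neg_cone_cases smS st_ab ut) => v vt vu v_a //.
by rewrite -(SM_mul_idem smS v); apply: le_trans ua; exact: smul_le2.
Qed.

End Glue.

Variable lowS : lower_closed S.

Definition cone_part (x : S) : lower_sig lowS := exist _ (x ∧ st) (leIr x st).

Definition cone_pair (x : S) : lower_sig lowS * lower_sig lowS :=
  (cone_part x, cone_part (¬ x)).

Definition cone_glue (p : lower_sig lowS * lower_sig lowS) : S :=
  proj1_sig (fst p) · ¬ proj1_sig (snd p).

Lemma cone_part_meet (x y : S) :
  cone_part (x ∧ y) = (cone_part x ⊓ cone_part y)%bRS.
Proof.
apply: sig_val_inj; apply: (lat_eq_le ordS) => z.
by rewrite !(lat_lexI ordS); tauto.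
Qed.

Lemma cone_part_join (x y : S) :
  cone_part (x ∨ y) = (cone_part x ⊔ cone_part y)%bRS.
Proof.
by apply: sig_val_inj; rewrite /= !(meetC latS _ st) (SM_distributive smS).
Qed.

Lemma cone_pair_meet (x y : S) :
  cone_pair (x ∧ y) = pair_meet (cone_pair x) (cone_pair y).
Proof. by rewrite /cone_pair /= (snegI smS) cone_part_meet cone_part_join. Qed.

Lemma cone_pair_join (x y : S) :
  cone_pair (x ∨ y) = pair_join (cone_pair x) (cone_pair y).
Proof. by rewrite /cone_pair /= (snegU smS) cone_part_meet cone_part_join. Qed.

Lemma cone_pair_neg (x : S) : cone_pair (¬ x) = pair_neg (cone_pair x).
Proof. by rewrite /cone_pair /= (SM_negK smS). Qed.

Lemma cone_pair_bowtie (x : S) : in_bowtie (cone_pair x).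
Proof.
split.
  exact/sig_val_inj/(neg_cone_cover smS)/(st_le_excluded_middle smS).
apply/ble_sle/(le_trans (smeet_le_mul smS _ _)).
by apply: le_trans (smul_neg_le smS x); apply: (smul_le2 smS); exact: leIl.
Qed.

Lemma cone_pair_inj (x y : S) : cone_pair x = cone_pair y -> x = y.
Proof.
suff le_of_pair u v : cone_pair u = cone_pair v -> u ≤ v.
  by move=> xy; apply: (lat_le_anti ordS); exact: le_of_pair.
case=> uv /esym nuv; apply/(sle_lattice smS); rewrite !(meetC latS st) uv nuv.
by split; exact: leIl.
Qed.

Lemma cone_glueK (p : lower_sig lowS * lower_sig lowS) :
  in_bowtie p -> cone_pair (cone_glue p) = p.
Proof.
case: p => [[a a_st] [b b_st]] [ab_t /ble_sle ab_f].
have st_ab : st ≤ a ∨ b.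
  by move/(f_equal (@proj1_sig _ _)): ab_t => /= ->; exact: lexx.
congr pair; apply: sig_val_inj.
- exact: glue_meet_st.
- exact: neg_glue_meet_st.
Qed.

Lemma cone_pairK (x : S) : cone_glue (cone_pair x) = x.
Proof. exact/cone_pair_inj/cone_glueK/cone_pair_bowtie. Qed.

Variable upS : upper_closed (lower_sig lowS).

Definition cone_split (x : S) : upper_sig upS :=
  exist _ (cone_pair x) (cone_pair_bowtie x).

Definition cone_merge (u : upper_sig upS) : S := cone_glue (proj1_sig u).

Lemma cone_splitK : cancel cone_split cone_merge.
Proof. exact: cone_pairK. Qed.

Lemma cone_mergeK : cancel cone_merge cone_split.
Proof. by case=> p bow_p; apply: sig_val_inj; exact: cone_glueK. Qed.

Lemma cone_split_hom : is_SM_hom cone_split.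
Proof.
have smT := bowtie_SM (neg_cone_bRS smS lowS) upS.
apply: (SM_hom_of_lattice_iso smS smT cone_splitK cone_mergeK) => [x y|x y|x|].
all: apply: sig_val_inj.
- exact: cone_pair_meet.
- exact: cone_pair_join.
- exact: cone_pair_neg.
- by congr pair; apply: sig_val_inj; [exact: lexx | exact: (sneg_st_le smS)].
Qed.

Lemma cone_merge_hom : is_SM_hom cone_merge.
Proof. exact: SM_hom_inverse cone_splitK cone_mergeK cone_split_hom. Qed.

End ConePair.

Section BowtieUnit.

Variable A : bRS_sig.
Hypothesis brsA : is_bRS A.
Variables (upA : upper_closed A) (lowA : lower_closed (upper_sig upA)).

Let brA := relative_Stone_Brouwerian (bRS_relative_Stone brsA).
Let latA := Brouwerian_lattice brA.
Let ordA := ble_lattice_order brA.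

Lemma unit_bowtie (a : A) : in_bowtie (a, a ⇀ bf).
Proof.
split; first exact: (bRS_f brsA).
by rewrite (meetC latA) (bimp_meet brA); exact: (lat_leIl ordA).
Qed.

Lemma bowtie_neg_coneP (u : upper_sig upA) :
  in_neg_cone u <-> (bf ⊑ snd (proj1_sig u))%bRS.
Proof.
case: u => [[a b] ?]; rewrite /in_neg_cone /sle /=; split.
  by move/(f_equal (@proj1_sig _ _)) => -[_ <-]; exact: (lat_leUr ordA).
move=> /(lat_join_r ordA) fb; apply: sig_val_inj => /=.
by rewrite (bmeett brA) (joinC latA) fb.
Qed.

Lemma bowtie_neg_cone_snd (u : upper_sig upA) :
  in_neg_cone u -> snd (proj1_sig u) = fst (proj1_sig u) ⇀ bf.
Proof.
move=> /bowtie_neg_coneP; case: u => [[a b] [ab_t ab_f]] /= fb.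
apply: (lat_le_anti ordA); first exact/(bimpPl brA).
rewrite -(bmeett brA (a ⇀ bf)) -ab_t (bmeetUr brA) (bimp_meet brA).
apply/(lat_leUx ordA); split; last exact: (lat_leIr ordA).
exact: (lat_le_trans ordA) (lat_leIl ordA _ _) fb.
Qed.

Lemma unit_neg_cone (a : A) :
  @in_neg_cone (upper_sig upA) (exist _ (a, a ⇀ bf) (unit_bowtie a)).
Proof. exact/bowtie_neg_coneP/(ble_imp brA). Qed.

Definition bowtie_unit (a : A) : lower_sig lowA :=
  exist _ (exist _ (a, a ⇀ bf) (unit_bowtie a) : upper_sig upA)
    (unit_neg_cone a).

Definition bowtie_fst (u : lower_sig lowA) : A := fst (proj1_sig (proj1_sig u)).

Lemma bowtie_unitK : cancel bowtie_unit bowtie_fst.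
Proof. by []. Qed.

Lemma bowtie_fst_inj (u v : lower_sig lowA) :
  bowtie_fst u = bowtie_fst v -> u = v.
Proof.
case: u v => [u bow_u] [v bow_v]; rewrite /bowtie_fst /= => uv.
do 2! apply: sig_val_inj => /=; apply: injective_projections => //.
by rewrite !bowtie_neg_cone_snd // uv.
Qed.

Lemma bowtie_fstK : cancel bowtie_fst bowtie_unit.
Proof. by move=> u; exact: bowtie_fst_inj. Qed.

Lemma bowtie_unit_hom : is_bRS_hom bowtie_unit.
Proof.
have f_imp (a : A) : bf ⇀ (a ⇀ bf) = bt.
  by apply/(bimp_eq_top brA); exact: (ble_imp brA).
split=> [a b|a b|a b||]; apply: bowtie_fst_inj; rewrite /bowtie_fst //=.
by rewrite !f_imp (bimpt brA) !(bmeett brA).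
Qed.

End BowtieUnit.

Lemma bowtie_upper_functor (w : upper_well_defined) :
  is_functor (bowtie_upper w).
Proof.
split=> [A | A B C v u]; apply: SM_hom_eq; apply: funext => -[[a b] ?];
  exact: sig_val_inj.
Qed.

Lemma bowtie_lower_functor (w : lower_well_defined) :
  is_functor (bowtie_lower w).
Proof.
split=> [S | S T U v u]; apply: bRS_hom_eq; apply: funext => x;
  exact: sig_val_inj.
Qed.

Lemma bowtie_unit_iso (up : upper_well_defined) (low : lower_well_defined) :
  naturally_isomorphic (id_assignment bRSA)
    (comp_assignment (bowtie_lower low) (bowtie_upper up)).
Proof.
pose eta (A : bRSA) : bRS_hom A (bowtie_lower low (bowtie_upper up A)) :=
  @BRSHom A (lower_ob low (upper_ob up A)) _
    (bowtie_unit_hom (bRS_axioms A) (lower_ob_closed low (upper_ob up A))).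
exists eta; split=> [A B u | A].
  apply: bRS_hom_eq; apply: funext => a.
  exact: (bowtie_fst_inj (bRS_axioms B)).
apply: (@bRS_is_iso _ _ (eta A)); first exact: bowtie_unitK.
exact: (bowtie_fstK (bRS_axioms A)).
Qed.

Lemma bowtie_counit_iso (up : upper_well_defined) (low : lower_well_defined) :
  naturally_isomorphic (comp_assignment (bowtie_upper up) (bowtie_lower low))
    (id_assignment SM).
Proof.
pose eps (S : SM) : SM_hom (bowtie_upper up (bowtie_lower low S)) S :=
  @SMHom (upper_ob up (lower_ob low S)) S _
    (cone_merge_hom (SM_axioms S) (upper_ob_closed up (lower_ob low S))).
exists eps; split=> [S T u | S].
  apply: SM_hom_eq; apply: funext => -[[a b] ?] /=.
  rewrite /cone_merge /cone_glue /=.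
  by rewrite (SM_hom_mul (SM_funP u)) (SM_hom_neg (SM_funP u)).
apply: (@SM_is_iso _ _ (eps S)); first exact: (cone_mergeK (SM_axioms S)).
exact: (cone_splitK (SM_axioms S)).
Qed.

Theorem mainTheorem3 :
  exists (up : upper_well_defined) (low : lower_well_defined),
    witness_equivalence (bowtie_upper up) (bowtie_lower low).
Proof.
exists bowtie_upper_well_defined, bowtie_lower_well_defined; split.
  exact: bowtie_upper_functor.
split; first exact: bowtie_lower_functor.
by split; [exact: bowtie_unit_iso | exact: bowtie_counit_iso].
Qed.
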